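(* Let $u\in\mathcal V\cap H^1_0(\Omega)$ solve $-\Delta u=f$ in $\Omega$, $u=0$ on $\partial\Omega$. If $C>C_P$, then $$\mathcal J_f^C(v)\ \ge\ \mathcal J_f^C(u)\qquad\text{for all } v\in\mathcal V,$$ and, for $v\in\mathcal V$, equality $\mathcal J_f^C(v)=\mathcal J_f^C(u)$ holds if and only if $v-u$ is a constant.
   Context: $\Omega\subset\mathbb R^d$ is a bounded connected Lipschitz domain; functions are real-valued. Write $\|v\|_0=\|v\|_{L^2(\Omega)}$ and $|v|_1=\|\nabla v\|_{L^2(\Omega)}$. The space $\mathcal V=\{v\in H^1(\Omega):\Delta v\in L^2(\Omega)\}$, where the Laplacian is understood in the distributional sense (no boundary condition is imposed). The source is $f\in L^2(\Omega)$, and it is assumed that the homogeneous Dirichlet problem $-\Delta u=f$ in $\Omega$, $u=0$ on $\partial\Omega$ admits a solution $u\in\mathcal V\cap H^1_0(\Omega)$. For $C>0$ define $$\mathcal J_f^C(v)=C\|\Delta v+f\|_0+|v|_1,\qquad v\in\mathcal V .$$ The constant $C_P$ is the sharp Dirichlet Poincaré constant of $\Omega$: $C_P:=\sup_{0\ne w\in H^1_0(\Omega)}\|w\|_0/|w|_1=1/\sqrt{\lambda_1^D(\Omega)}$, where $\lambda_1^D(\Omega)$ is the first Dirichlet eigenvalue of $-\Delta$ on $\Omega$. *)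

(* Defs.v *)
From HB Require Import structures.
From mathcomp Require Import all_boot all_order all_algebra.
From mathcomp Require Import all_classical all_reals all_analysis.

Set Implicit Arguments.
Unset Strict Implicit.
Unset Printing Implicit Defensive.

Import Order.TTheory GRing.Theory Num.Theory.
Import numFieldTopology.Exports numFieldNormedType.Exports.

Local Open Scope classical_set_scope.
Local Open Scope ring_scope.

Fact rV_display : measure_display. Proof. by constructor. Qed.

Section measurable_rV.
Context {R : realType} {n : nat}.

Definition rV_coor (i : 'I_n) (x : 'rV[R]_n) : measurableTypeR R := x ord0 i.

Let rV_set0 : g_sigma_preimage rV_coor set0.
Proof. exact: sigma_algebra0. Qed.

Let rV_setC A : g_sigma_preimage rV_coor A -> g_sigma_preimage rV_coor (~` A).
Proof. exact: sigma_algebraC. Qed.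

Let rV_bigcup (F : _^nat) : (forall i, g_sigma_preimage rV_coor (F i)) ->
  g_sigma_preimage rV_coor (\bigcup_i (F i)).
Proof. exact: sigma_algebra_bigcup. Qed.

(* Generated by the coordinates, hence the Borel sigma-algebra of R^n. *)
HB.instance Definition _ := @isMeasurable.Build rV_display
  'rV[R]_n (g_sigma_preimage rV_coor) rV_set0 rV_setC rV_bigcup.

Lemma measurable_rV_coor i : measurable_fun [set: 'rV[R]_n] (rV_coor i).
Proof.
move=> _ Y mY; rewrite setTI; apply: sub_sigma_algebra => /=.
rewrite -bigcup_seq/=; exists i => /=; first by rewrite mem_index_enum.
by exists Y => //; rewrite setTI.
Qed.

Lemma measurable_fun_rVP d (T : measurableType d) (f : T -> 'rV[R]_n) :
  (forall i, measurable_fun [set: T] (rV_coor i \o f)) ->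
  measurable_fun [set: T] f.
Proof.
move=> mf _ A mA; rewrite setTI.
have : preimage_set_system [set: T] f (g_sigma_preimage rV_coor) `<=` measurable.
  rewrite -g_sigma_preimage_comp; apply: smallest_sub.
    exact: sigma_algebra_measurable.
  rewrite -bigcup_seq/=; apply: bigcup_sub => i _.
  by move=> _ [B mB <-]; exact: mf.
by apply; exists A => //; rewrite setTI.
Qed.

End measurable_rV.

Section lebesgue_rV.
Context {R : realType}.
Local Open Scope ereal_scope.

Definition rV_cons {n} (p : measurableTypeR R * 'rV[R]_n) : 'rV[R]_n.+1 :=
  row_mx (p.1 : R)%:M p.2.

Lemma rV_cons0 n (p : measurableTypeR R * 'rV[R]_n) :
  rV_cons p ord0 ord0 = p.1.
Proof.
have -> : rV_cons p ord0 ord0 = rV_cons p ord0 (lshift n (@ord0 0)).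
  by congr (rV_cons p ord0 _); exact/val_inj.
by rewrite [LHS](@row_mxEl _ 1 1 n) mxE.
Qed.

Lemma rV_consS n (p : measurableTypeR R * 'rV[R]_n) i :
  rV_cons p ord0 (lift ord0 i) = p.2 ord0 i.
Proof.
have -> : rV_cons p ord0 (lift ord0 i) = rV_cons p ord0 (rshift 1 i).
  by congr (rV_cons p ord0 _); exact/val_inj.
by rewrite [LHS](@row_mxEr _ 1 1 n).
Qed.

Lemma measurable_rV_cons n : measurable_fun setT (@rV_cons n).
Proof.
apply: measurable_fun_rVP => i; case: (unliftP ord0 i) => [j ->|->].
- rewrite (_ : _ \o _ = rV_coor j \o snd).
    exact: (measurableT_comp (measurable_rV_coor j)).
  by apply/funext => p /=; exact: rV_consS.
- rewrite (_ : _ \o _ = fst) //.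
  by apply/funext => p /=; exact: rV_cons0.
Qed.

Section step.
Context {n : nat} (m : {sigma_finite_measure set 'rV[R]_n -> \bar R}).

Definition rV_step : set 'rV[R]_n.+1 -> \bar R :=
  pushforward (@lebesgue_measure R \x m) rV_cons.

Let rV_step0 : rV_step set0 = 0.
Proof. by rewrite /rV_step /pushforward preimage_set0 measure0. Qed.

Let rV_step_ge0 A : 0 <= rV_step A.
Proof. by rewrite /rV_step /pushforward measure_ge0. Qed.

Let rV_step_additive : semi_sigma_additive rV_step.
Proof.
move=> F mF tF mUF; rewrite /rV_step /pushforward preimage_bigcup.
have mc A : measurable A -> measurable (@rV_cons n @^-1` A).
  by move=> mA; rewrite -[X in measurable X]setTI; exact: measurable_rV_cons.
apply: measure_semi_sigma_additive.
- by move=> i; exact: mc.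
- apply/trivIsetP => /= i j _ _ ij; rewrite -preimage_setI.
  by move/trivIsetP : tF => /(_ i j Logic.I Logic.I ij) ->; rewrite preimage_set0.
- by rewrite -preimage_bigcup; exact: mc.
Qed.

HB.instance Definition _ :=
  isMeasure.Build _ _ _ rV_step rV_step0 rV_step_ge0 rV_step_additive.

Let rV_step_sigma_finite : sigma_finite setT rV_step.
Proof.
have /sigma_finiteP[F [TF ndF Foo]] := sigma_finiteT (@lebesgue_measure R).
have /sigma_finiteP[G [TG ndG Goo]] := sigma_finiteT m.
pose tl (x : 'rV[R]_n.+1) : measurableTypeR R * 'rV[R]_n :=
  (rV_coor ord0 x, @rsubmx _ 1 1 n x).
have mtl : measurable_fun setT tl.
  apply/measurable_fun_pair; first exact: measurable_rV_coor.
  apply: measurable_fun_rVP => i.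
  rewrite (_ : _ \o _ = rV_coor (lift ord0 i)); first exact: measurable_rV_coor.
  by apply/funext => x; rewrite /rV_coor /= mxE; congr (x _ _); exact/val_inj.
have tlK : cancel rV_cons tl.
  by move=> p; rewrite /tl /rV_coor rV_cons0 /rV_cons row_mxKr -surjective_pairing.
exists (fun k => tl @^-1` (F k `*` G k)).
  rewrite -preimage_bigcup (_ : \bigcup_k _ = setT) ?preimage_setT//.
  apply/seteqP; split => // -[x y] _.
  have [i _ Fix] : (\bigcup_k F k) x by rewrite -TF.
  have [j _ Gjy] : (\bigcup_k G k) y by rewrite -TG.
  exists (maxn i j) => //; split.
    by move: x Fix; exact/subsetPset/ndF/leq_maxl.
  by move: y Gjy; exact/subsetPset/ndG/leq_maxr.
move=> k; have [mFk Fkoo] := Foo k; have [mGk Gkoo] := Goo k; split.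
  by rewrite -[X in measurable X]setTI; apply: mtl => //; exact: measurableX.
rewrite /rV_step /pushforward -comp_preimage (_ : tl \o rV_cons = id).
  by rewrite preimage_id product_measure1E// lte_mul_pinfty// ge0_fin_numE.
by apply/funext => p /=; rewrite tlK.
Qed.

HB.instance Definition _ :=
  Measure_isSigmaFinite.Build _ _ _ rV_step rV_step_sigma_finite.

End step.

(* 'rV[R]_0 is a one-point space, so counting on it is the Dirac mass. *)
Fixpoint lebesgue_rV n : {sigma_finite_measure set 'rV[R]_n -> \bar R} :=
  match n with
  | 0%N => \d_(0%R : 'rV[R]_0)
  | n'.+1 => rV_step (lebesgue_rV n')
  end.

Lemma lebesgue_rV_box n (A : 'I_n -> set R) :
  (forall i, measurable (A i : set (measurableTypeR R))) ->
  lebesgue_rV n [set x : 'rV[R]_n | forall i, A i (x ord0 i)] =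
  \prod_(i < n) @lebesgue_measure R (A i).
Proof.
elim: n A => [A _|n IH A mA].
  by rewrite big_ord0 /= diracE mem_set//= => -[].
rewrite big_ord_recl /= /rV_step /pushforward.
rewrite -(IH (fun i => A (lift ord0 i))) //.
have mB : measurable [set x : 'rV[R]_n | forall i, A (lift ord0 i) (x ord0 i)].
  rewrite (_ : [set x | _] =
    \bigcap_(i in [set: 'I_n]) (rV_coor i @^-1` A (lift ord0 i))).
    apply: fin_bigcap_measurable => // i _.
    by rewrite -[X in measurable X]setTI; exact: measurable_rV_coor.
  by apply/seteqP; split => x h i; [move=> _; exact: h|exact: (h i)].
rewrite -product_measure1E//; congr (_ _).
apply/seteqP; split => -[a x] /=.
- move=> h; split => [|i]; first by have := h ord0; rewrite rV_cons0.
  by have := h (lift ord0 i); rewrite rV_consS.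
- move=> [h1 h2] i; case: (unliftP ord0 i) => [j ->|->].
    by rewrite rV_consS; exact: h2.
  by rewrite rV_cons0.
Qed.

End lebesgue_rV.

Section domain.
Context {R : realType}.

(* The norm `|x| of the library on 'rV[R]_n is the sup norm. *)
Definition enorm {n} (x : 'rV[R]_n) : R := Num.sqrt (\sum_(i < n) x ord0 i ^+ 2).

Context {d : nat}.
Local Notation E := 'rV[R]_d.+1.

(* Near each boundary point and up to a rigid motion, Omega is the part of a
   Euclidean ball lying strictly above the graph of a Lipschitz function of the
   first d coordinates. *)
Definition lipschitz_boundary (Omega : set E) : Prop :=
  forall x0 : E, closure Omega x0 -> closure (~` Omega) x0 ->
  exists (r : R) (Q : 'M[R]_d.+1) (gamma : 'rV[R]_d -> R) (L : R),
    [/\ 0 < r, Q *m Q^T = 1%:M,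
        forall a b, `|gamma a - gamma b| <= L * enorm (a - b) &
        forall x, enorm (x - x0) < r ->
          let y := (x - x0) *m Q in
          Omega x <-> gamma (col' ord_max y) < y ord0 ord_max].

Definition bounded_lipschitz_domain (Omega : set E) : Prop :=
  [/\ open Omega, Omega !=set0, connected Omega, bounded_set Omega &
      lipschitz_boundary Omega].

End domain.

Section sobolev.
Context {R : realType} {d : nat}.
Local Notation E := 'rV[R]_d.+1.
Local Notation mu := (@lebesgue_rV R d.+1).
Implicit Types (Omega : set E) (v w phi : E -> R).

(* Functions on Omega are given by total functions on E, of which only the values
   on Omega matter; equality in L^2 is equality almost everywhere on Omega.  Note
   that v \_ Omega is v extended by 0 outside of Omega. *)
Definition ae_on Omega (P : E -> Prop) : Prop := {ae mu, forall x, Omega x -> P x}.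

Definition L2 Omega : set (E -> R) := [set v | v \_ Omega \in Lfun mu 2%:E].

Definition L2norm Omega v : R := fine ('N[mu]_2%:E[EFin \o (v \_ Omega)])%E.

Definition partial (i : 'I_d.+1) phi : E -> R := fun x => 'D_(delta_mx ord0 i) phi x.

Definition grad phi : E -> E := fun x => \row_i partial i phi x.

Definition laplacian phi : E -> R := fun x => \sum_i partial i (partial i phi) x.

Fixpoint Ck (k : nat) phi : Prop :=
  continuous phi /\
  if k is k'.+1 then
    forall i, (forall x, derivable phi x (delta_mx ord0 i)) /\ Ck k' (partial i phi)
  else True.

(* C_c^oo(Omega) *)
Definition test_function Omega : set (E -> R) :=
  [set phi | [/\ forall k, Ck k phi,
                 compact (closure [set x | phi x != 0]) &
                 closure [set x | phi x != 0] `<=` Omega]].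

Definition is_weak_grad Omega v (G : E -> E) : Prop :=
  forall i, L2 Omega (fun x => G x ord0 i) /\
    forall phi, test_function Omega phi ->
      \int[mu]_(x in Omega) (v x * partial i phi x) =
      - \int[mu]_(x in Omega) (G x ord0 i * phi x).

Definition is_weak_laplacian Omega v h : Prop :=
  L2 Omega h /\
  forall phi, test_function Omega phi ->
    \int[mu]_(x in Omega) (v x * laplacian phi x) =
    \int[mu]_(x in Omega) (h x * phi x).

(* Representatives of the (almost everywhere unique) weak gradient and
   distributional Laplacian, when these exist in L^2(Omega). *)
Definition weak_grad Omega v : E -> E := xget (cst 0) (is_weak_grad Omega v).

Definition weak_laplacian Omega v : E -> R :=
  xget (cst 0) (is_weak_laplacian Omega v).

Definition sobolev_H1 Omega : set (E -> R) :=
  [set v | L2 Omega v /\ exists G, is_weak_grad Omega v G].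

Definition H1_seminorm Omega v : R :=
  L2norm Omega (fun x => enorm (weak_grad Omega v x)).

(* The closure of C_c^oo(Omega) in H^1(Omega). *)
Definition sobolev_H10 Omega : set (E -> R) :=
  [set w | sobolev_H1 Omega w /\
    forall e : R, 0 < e -> exists phi,
      [/\ test_function Omega phi,
          L2norm Omega (fun x => w x - phi x) < e &
          L2norm Omega (fun x => enorm (weak_grad Omega w x - grad phi x)) < e]].

Definition calV Omega : set (E -> R) :=
  [set v | sobolev_H1 Omega v /\ exists h, is_weak_laplacian Omega v h].

Definition J Omega (f : E -> R) (C : R) v : R :=
  C * L2norm Omega (fun x => weak_laplacian Omega v x + f x) + H1_seminorm Omega v.

(* The supremum is taken in the extended reals, so that it is meaningful before
   the Poincare inequality is known. *)
Definition C_P Omega : \bar R :=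
  ereal_sup [set (L2norm Omega w / H1_seminorm Omega w)%:E |
              w in [set w | sobolev_H10 Omega w /\ ~ ae_on Omega (fun x => w x = 0)]].

End sobolev.

(* Main.v *)
From HB Require Import structures.
Require Import Defs.
From mathcomp Require Import all_boot all_order all_algebra.
From mathcomp Require Import all_classical all_reals all_analysis.
From mathcomp Require Import measurable_realfun ring lra.
Set Implicit Arguments.
Unset Strict Implicit.
Unset Printing Implicit Defensive.
Import Order.TTheory GRing.Theory Num.Theory.
Import numFieldTopology.Exports numFieldNormedType.Exports.
Local Open Scope classical_set_scope.
Local Open Scope ring_scope.

(** Green's formula for test functions, <grad v, grad phi> = - <Delta v, phi>,
    extends by density from phi in C_c^oo(Omega) to u in H^1_0(Omega)
    ([green_H10]).  Applied to v and to u, with - Delta u = f, it yields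
      |u|_1^2 - <grad v, grad u> = <Delta v + f, u>          ([energy_identity]).
    Cauchy-Schwarz on both scalar products and the Poincare inequality for u,
    whose constant c satisfies c < C, then give
      |u|_1 <= |v|_1 + c ||Delta v + f||_0                   ([seminorm_le]),
    and the left-hand side is J(u), since the residual of u vanishes.  If
    J(v) = J(u), then c < C forces Delta v + f = 0, hence |v|_1 = |u|_1 and
    <grad v, grad u> = |u|_1^2, that is, grad v = grad u ([J_eq_grad]).

    Two facts about weak derivatives remain.

    Adding a constant changes neither the weak gradient nor the distributional
    Laplacian ([J_shift]): the integral of a partial derivative of a test
    function vanishes, which follows from the translation invariance of the
    Lebesgue measure by dominated convergence of difference quotients
    ([integral_partial0]).

    A function w with zero weak gradient on a connected open set is almost
    everywhere constant ([weak_grad0_constancy]).  It is tested against products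
    of functions of one coordinate.  In the direction i of the derivative, the factor
    approximates a primitive of
      1_(]a, b]) / (b - a) - 1_(]a', b']) / (b' - a'),
    which has compact support because that function has integral zero; the other
    factors approximate indicator functions of intervals.  In the limit, the mean
    of w over a box does not change when one of its sides is replaced
    ([box_average_eq]), so that all the boxes of a small cube have the same mean.
    By the pi-lambda theorem w is almost everywhere equal to that mean on the
    cube ([local_constancy]), and connectedness concludes
    ([connected_constancy]). *)
(** * Boxes and the Lebesgue measure *)

Section boxes.
Context {R : realType} {n : nat}.
Local Notation E := 'rV[R]_n.
Implicit Types (a b x : E).

Definition box a b : set E := [set x | forall i, a ord0 i < x ord0 i <= b ord0 i].

Definition boxes : set (set E) := [set box a b | a in setT & b in setT].

Lemma boxE a b :
  box a b = [set x | forall i, `]a ord0 i, b ord0 i]%classic (x ord0 i)].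
Proof. by apply/seteqP; split => x /= h i; have := h i; rewrite /= in_itv. Qed.

Lemma measurable_box a b : measurable (box a b).
Proof.
rewrite (_ : box a b =
    \bigcap_(i in [set: 'I_n]) (rV_coor i @^-1` `]a ord0 i, b ord0 i]%classic)).
  apply: fin_bigcap_measurable => // i _.
  rewrite -[X in measurable X]setTI; apply: measurable_rV_coor => //.
by rewrite boxE; apply/seteqP; split => x h i; [move=> _; exact: h|exact: (h i)].
Qed.

Lemma boxI a b a' b' : box a b `&` box a' b' =
  box (\row_i Num.max (a ord0 i) (a' ord0 i))
      (\row_i Num.min (b ord0 i) (b' ord0 i)).
Proof.
apply/seteqP; split => x /=.
  move=> [h h'] i; rewrite !mxE gt_max le_min.
  by move: (h i) (h' i) => /andP[-> ->] /andP[-> ->].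
move=> h; split => i; move: (h i); rewrite !mxE gt_max le_min.
  by move=> /andP[/andP[-> _] /andP[-> _]].
by move=> /andP[/andP[_ ->] /andP[_ ->]].
Qed.

Lemma setI_closed_boxes : setI_closed boxes.
Proof.
move=> _ _ [a _ [b _ <-]] [a' _ [b' _ <-]]; rewrite boxI.
by eexists => //; eexists.
Qed.

Definition cube (k : nat) : set E := box (const_mx (- k%:R)) (const_mx k%:R).

Lemma boxes_cube k : boxes (cube k).
Proof. by exists (const_mx (- k%:R)) => //; exists (const_mx k%:R). Qed.

Lemma bigcup_cube : \bigcup_k cube k = setT.
Proof.
apply/seteqP; split => // x _.
exists (\max_(i < n) (Num.truncn `|x ord0 i|).+1) => // i /=; rewrite !mxE.
have xi : `|x ord0 i| < (\max_(i < n) (Num.truncn `|x ord0 i|).+1)%:R.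
  apply: lt_le_trans (truncnS_gt _) _.
  by rewrite ler_nat; exact: (@leq_bigmax _ (fun i => (Num.truncn `|x ord0 i|).+1)).
by move: xi; rewrite ltr_norml => /andP[-> /ltW ->].
Qed.

(** Coordinate slabs are countable unions of boxes, the other coordinates being
    confined to ]-k, k]; hence boxes generate the sigma-algebra, and two measures
    are compared, or a function is shown to vanish, on boxes only. *)
Lemma measurable_boxesE : (measurable : set (set E)) = <<s boxes >>.
Proof.
apply/seteqP; split; last first.
  apply: smallest_sub; first exact: sigma_algebra_measurable.
  by move=> _ [a _ [b _ <-]]; exact: measurable_box.
apply: smallest_sub; first exact: smallest_sigma_algebra.
rewrite -bigcup_seq/=; apply: bigcup_sub => i _ _ [B mB <-].
pose T := g_sigma_algebraType boxes.
have mf : measurable_fun [set: T] (rV_coor i : T -> measurableTypeR R).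
  apply: (@measurability _ _ T (measurableTypeR R) setT (rV_coor i) (@ocitv R)) => //.
  move=> _ [_ [[a b] _ <-] <-].
  pose A k : T := \row_j (if j == i then a else - k%:R).
  pose B' k : T := \row_j (if j == i then b else k%:R).
  have -> : [set: T] `&` (rV_coor i @^-1` `]a, b]%classic) =
      \bigcup_k (box (A k) (B' k) : set T).
    rewrite setTI; apply/seteqP; split => x /=.
      rewrite in_itv/= /rV_coor => xi.
      have [k _ kx] : (\bigcup_k cube k) x by rewrite bigcup_cube.
      exists k => // j; rewrite !mxE; case: eqP => [->//|_].
      by have := kx j; rewrite !mxE.
    by move=> [k _ /(_ i)]; rewrite !mxE eqxx in_itv.
  apply: bigcupT_measurable => k.
  by apply: sub_sigma_algebra; exists (A k) => //; exists (B' k).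
by have := mf measurableT _ mB; rewrite setTI.
Qed.

Lemma lebesgue_box a b : (forall i, a ord0 i <= b ord0 i) ->
  lebesgue_rV n (box a b) = (\prod_(i < n) (b ord0 i - a ord0 i))%:E.
Proof.
move=> ab; rewrite boxE (@lebesgue_rV_box _ n (fun i => `]a ord0 i, b ord0 i]%classic)); last first.
  by move=> i; exact: measurable_itv.
rewrite -prodEFin; apply: eq_bigr => i _.
rewrite lebesgue_measure_itv/= lte_fin.
by have := ab i; rewrite le_eqVlt => /predU1P[->|-> //]; rewrite ltxx subrr.
Qed.

Lemma box0 a b i : b ord0 i <= a ord0 i -> box a b = set0.
Proof.
move=> ba; apply/seteqP; split => // x /(_ i) /andP[ax xb].
by have := lt_le_trans ax (le_trans xb ba); rewrite ltxx.
Qed.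

Lemma lebesgue_box_lty a b : (lebesgue_rV n (box a b) < +oo)%E.
Proof.
have [[i ba]|h] := pselect (exists i, b ord0 i <= a ord0 i).
  by rewrite (box0 ba) measure0.
rewrite lebesgue_box ?ltry// => i; rewrite leNgt; apply/negP => /ltW ba.
by apply: h; exists i.
Qed.

Lemma box_translate a b t : [set x | box a b (x + t)] = box (a - t) (b - t).
Proof.
by apply/seteqP; split => x h i; have := h i; rewrite !mxE ltrBlDr lerBrDr.
Qed.

End boxes.

Section borel.
Context {R : realType} {n : nat}.
Local Notation E := 'rV[R]_n.+1.
Implicit Types (a b x : E).

Lemma coord_le_norm x i : `|x ord0 i| <= `|x|.
Proof.
by rewrite [leRHS]/Num.norm /= mx_normrE; apply: (le_bigmax _ _ (ord0, i)).
Qed.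

Lemma ball_rVE x (r : R) : ball x r = [set y : E | forall i, `|x ord0 i - y ord0 i| < r].
Proof.
apply/seteqP; split => y /=.
  by move=> [_ h] i; exact: h.
move=> h; split; first exact: le_lt_trans (normr_ge0 _) (h ord0).
by move=> i j; rewrite (ord1 i); exact: h.
Qed.

Definition rat_box (p : 'rV[rat]_n.+1 * nat) : set E :=
  box (map_mx (ratr : rat -> R) p.1 - const_mx p.2.+1%:R^-1)
      (map_mx (ratr : rat -> R) p.1 + const_mx p.2.+1%:R^-1).

(** The sup-norm balls of the topology are cubes, so that boxes with rational
    centers form a countable basis of neighborhoods. *)
Lemma rat_box_basis (U : set E) x : open U -> U x ->
  exists2 p, rat_box p x & rat_box p `<=` U.
Proof.
move=> oU Ux.
have /nbhs_ballP[e /= e0 xU] : nbhs x U by exact: open_nbhs_nbhs.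
have [k ke] : exists k : nat, k.+1%:R^-1 < e / 2.
  exists (Num.truncn (2 / e)).
  by rewrite invf_plt ?posrE ?divr_gt0// invf_div truncnS_gt.
have k0 : 0 < k.+1%:R^-1 :> R by rewrite invr_gt0.
rewrite /rat_box; set dk : R := k.+1%:R^-1 in ke k0.
have /choice[q hq] : forall i, exists q : rat, `|x ord0 i - ratr q| < dk.
  move=> i; have lt : x ord0 i - dk < x ord0 i + dk by lra.
  have [q] := rat_in_itvoo lt; rewrite in_itv/= => /andP[q1 q2].
  by exists q; rewrite distrC ltr_distl q1 q2.
exists (\row_i q i, k); rewrite /= -/dk.
  move=> i; rewrite !mxE; move: (hq i); rewrite ltr_distl => /andP[x1 x2].
  by apply/andP; split; lra.
move=> y By; apply: xU; rewrite ball_rVE => i /=.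
move: (By i) (hq i); rewrite !mxE ltr_distl => /andP[y1 y2] /andP[x1 x2].
by rewrite ltr_distl; apply/andP; split; lra.
Qed.

Lemma open_measurable_rV (U : set E) : open U -> measurable U.
Proof.
move=> oU.
have -> : U = \bigcup_(p in [set p | rat_box p `<=` U]) rat_box p.
  apply/seteqP; split; last exact: bigcup_sub.
  by move=> x /(rat_box_basis oU)[p px pU]; exists p.
rewrite bigcup_mkcond; apply: countable_bigcupT_measurable => //.
by move=> p; case: ifPn => // _; exact: measurable_box.
Qed.

Lemma continuous_measurable_rV (f : E -> R) : continuous f ->
  measurable_fun [set: E] f.
Proof.
move=> cf; apply: (measurability _ (RGenOpens.measurableE R)).
move=> _ [_ [a [b ->] <-]]; rewrite setTI; apply: open_measurable_rV.
by move/continuousP : cf; apply; exact: interval_open.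
Qed.

Lemma measurable_translate (t : E) : measurable_fun [set: E] (fun x => x + t).
Proof.
apply: measurable_fun_rVP => i.
rewrite (_ : _ \o _ = fun x => rV_coor i x + t ord0 i).
  by apply: measurable_funD => //; exact: measurable_rV_coor.
by apply/funext => x; rewrite /rV_coor /= mxE.
Qed.

(** Both sides are measures in A that agree on boxes. *)
Lemma lebesgue_translate (t : E) (A : set E) : measurable A ->
  lebesgue_rV n.+1 [set x | A (x + t)] = lebesgue_rV n.+1 A.
Proof.
move=> mA.
pose T : {mfun E >-> E} :=
  HB.pack (fun x : E => x + t) (isMeasurableFun.Build _ _ _ _ _ (measurable_translate t)).
apply/esym.
apply: (@measure_unique _ _ _ boxes cube measurable_boxesE setI_closed_boxes boxes_cube
  bigcup_cube (lebesgue_rV n.+1) (pushforward (lebesgue_rV n.+1) T)) => //.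
  move=> _ [a _ [b _ <-]]; change (lebesgue_rV n.+1 (box a b) = lebesgue_rV n.+1 [set x | box a b (x + t)]).
  rewrite box_translate.
  have [[i ba]|h] := pselect (exists i, b ord0 i <= a ord0 i).
    by rewrite (box0 ba) (@box0 _ _ _ _ i) ?measure0// !mxE lerD2r.
  have ab i : a ord0 i <= b ord0 i.
    by rewrite leNgt; apply/negP => /ltW ba; apply: h; exists i.
  rewrite !lebesgue_box//; last by move=> i; rewrite !mxE lerD2r.
  by congr (_%:E); apply: eq_bigr => i _; rewrite !mxE; ring.
by move=> k; exact: lebesgue_box_lty.
Qed.

Lemma integral_translate (t : E) (f : E -> \bar R) :
  (lebesgue_rV n.+1).-integrable setT f ->
  (lebesgue_rV n.+1).-integrable setT (fun x => f (x + t)) /\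
  (\int[lebesgue_rV n.+1]_x f (x + t)%R = \int[lebesgue_rV n.+1]_x f x)%E.
Proof.
move=> intf; have mf := measurable_int _ intf.
have mt := measurable_translate t.
pose T : {mfun E >-> E} :=
  HB.pack (fun x : E => x + t) (isMeasurableFun.Build _ _ _ _ _ mt).
have pE (g : E -> \bar R) : (\int[pushforward (lebesgue_rV n.+1) T]_x g x =
                  \int[lebesgue_rV n.+1]_x g x)%E.
  by apply: eq_measure_integral => A mA _; exact: lebesgue_translate.
have mft : measurable_fun setT (fun x => f (x + t)) by exact: (measurableT_comp mf mt).
have ift : (lebesgue_rV n.+1).-integrable setT (fun x => f (x + t)).
  apply/integrableP; split => //.
  move/integrableP : intf => [_]; apply: le_lt_trans; rewrite -[leRHS]pE.
  rewrite (@ge0_integral_pushforward _ _ _ _ _ T mt)//.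
  by apply: measurableT_comp.
split => //; rewrite -[RHS]pE.
by rewrite (@integral_pushforward _ _ _ _ _ T mt).
Qed.

Lemma bounded_lty (A : set E) : measurable A -> bounded_set A ->
  (lebesgue_rV n.+1 A < +oo)%E.
Proof.
move=> mA [M0 [_ bM]]; set M := M0 + 1.
have AM x : A x -> `|x| <= M by move=> Ax; apply: bM => //; rewrite /M ltrDl.
apply: (@le_lt_trans _ _ (lebesgue_rV n.+1 (cube (Num.truncn M).+1))); last first.
  exact: lebesgue_box_lty.
apply: le_measure; rewrite ?inE//.
  exact: measurable_box.
move=> x /AM xM i; rewrite !mxE.
have xi : `|x ord0 i| < (Num.truncn M).+1%:R.
  apply: le_lt_trans (truncnS_gt _); apply: le_trans xM.
  exact: coord_le_norm.
by move: xi; rewrite ltr_norml => /andP[-> /ltW ->].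
Qed.

End borel.

(** * Square-integrable functions *)

Section quadratic.
Context {R : realType}.

(** The discriminant argument behind both Cauchy-Schwarz inequalities below, for
    functions and for vector fields. *)
Lemma quadratic_ge0_le (a b c : R) : 0 <= a -> 0 <= c ->
  (forall t, 0 <= a + 2 * t * b + t ^+ 2 * c) ->
  `|b| <= Num.sqrt a * Num.sqrt c.
Proof.
move=> a0 c0.
wlog b_ge0 : b / 0 <= b => [wl h|h].
  have [/wl|/ltW b0] := lerP 0 b; first exact.
  rewrite -normrN; apply: wl; first by rewrite oppr_ge0.
  by move=> t; have := h (- t); rewrite sqrrN !(mulrN, mulNr).
rewrite ger0_norm//.
have [b0|b0] := lerP b 0; first by rewrite (le_trans b0)// mulr_ge0// sqrtr_ge0.
have [c_eq0|cn0] := eqVneq c 0.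
  have := h (- (a + 1) / (2 * b)); rewrite c_eq0 mulr0 addr0.
  have -> : a + 2 * (- (a + 1) / (2 * b)) * b = -1 by field; lra.
  by lra.
have cgt0 : 0 < c by rewrite lt_neqAle eq_sym cn0.
have := h (- b / c).
have -> : a + 2 * (- b / c) * b + (- b / c) ^+ 2 * c = (a * c - b ^+ 2) / c.
  by field.
rewrite pmulr_lge0 ?invr_gt0// subr_ge0 => bac.
by rewrite -sqrtrM// -(ger0_norm (ltW b0)) -sqrtr_sqr ler_wsqrtr.
Qed.

End quadratic.

Section square_integrable.
Context {R : realType} {d : nat}.
Local Notation E := 'rV[R]_d.+1.
Local Notation mu := (@lebesgue_rV R d.+1).
Variable Omega : set E.
Hypothesis mO : measurable Omega.
Implicit Types (v w : E -> R) (G H : E -> E).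

(** Membership in L^2 in terms of integrals over Omega, instead of the extension
    by zero used to define [L2]. *)
Lemma L2P v : L2 Omega v <->
  measurable_fun Omega v /\ mu.-integrable Omega (EFin \o (fun x => v x ^+ 2)).
Proof.
have rE : (fun x => (v \_ Omega) x ^+ 2) = (fun x => v x ^+ 2) \_ Omega.
  by apply/funext => x; rewrite /patch; case: ifPn => // _; rewrite expr0n.
split => [Lv|[mv iv]].
  split.
    move: Lv; rewrite /L2 /= inE => /andP[]; rewrite !inE /= => mv _.
    exact/(measurable_restrictT _ mO).
  move: Lv => /Lfun2_integrable_sqr; rewrite rE.
  by rewrite (integrable_mkcond _ mO) restrict_EFin.
rewrite /L2 /= inE; apply/andP; split.
  by rewrite inE /=; exact/(measurable_restrictT _ mO).
rewrite inE /= /finite_norm unlock; apply: poweR_lty.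
rewrite (_ : integral _ _ _ = integral mu setT (EFin \o (fun x => v x ^+ 2) \_ Omega)).
  move: iv; rewrite (integrable_mkcond _ mO) restrict_EFin => /integrable_fin_num.
  by move=> /(_ measurableT); rewrite ltey_eq => ->.
rewrite -rE; apply: eq_integral => x _ /=.
by rewrite powR_mulrn// real_normK// num_real.
Qed.

Lemma L2normE v : L2norm Omega v = Num.sqrt (\int[mu]_(x in Omega) (v x ^+ 2)).
Proof.
rewrite /L2norm unlock fine_poweR.
have -> : fine (\int[mu]_x (`|(EFin \o v \_ Omega) x| `^ 2))%E =
   \int[mu]_(x in Omega) (v x ^+ 2).
  rewrite Rintegral_mkcond /Rintegral; congr fine; apply: eq_integral => x _.
  rewrite /= powR_mulrn// real_normK ?num_real//; congr EFin.
  by rewrite /patch; case: ifPn => // _; rewrite expr0n.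
by rewrite powR12_sqrt// Rintegral_ge0// => x _; exact: sqr_ge0.
Qed.

Lemma L2norm_ge0 v : 0 <= L2norm Omega v.
Proof. by rewrite L2normE sqrtr_ge0. Qed.

Lemma L2norm0 : L2norm Omega (cst 0) = 0.
Proof.
rewrite L2normE; under eq_Rintegral do rewrite expr0n /=.
by rewrite Rintegral_cst// mul0r sqrtr0.
Qed.

Lemma L2norm_sqr v : L2norm Omega v ^+ 2 = \int[mu]_(x in Omega) (v x ^+ 2).
Proof.
by rewrite L2normE sqr_sqrtr// Rintegral_ge0// => x _; exact: sqr_ge0.
Qed.

Lemma eq_L2norm_ae v w : measurable_fun Omega v -> measurable_fun Omega w ->
  ae_on Omega (fun x => v x = w x) -> L2norm Omega v = L2norm Omega w.
Proof.
move=> mv mw vw; rewrite !L2normE; congr Num.sqrt; congr fine.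
apply: ae_eq_integral => //.
- exact/measurable_EFinP/measurable_funX.
- exact/measurable_EFinP/measurable_funX.
- by move: vw; rewrite /ae_on; apply: filterS => x h Ox /=; rewrite (h Ox).
Qed.

Lemma L2_measurable v : L2 Omega v -> measurable_fun Omega v.
Proof. by case/L2P. Qed.

Lemma L2_mul_integrable v w : L2 Omega v -> L2 Omega w ->
  mu.-integrable Omega (EFin \o (fun x => v x * w x)).
Proof.
move=> Lv Lw; rewrite (integrable_mkcond _ mO) restrict_EFin.
have := Lfun2_mul_Lfun1 Lv Lw => /Lfun1_integrable.
congr (integrable mu setT (EFin \o _)); apply/funext => x /=.
by rewrite /patch; case: ifPn => //; rewrite mulr0.
Qed.

Lemma L2Z c v : L2 Omega v -> L2 Omega (fun x => c * v x).
Proof.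
move=> Lv; have /L2P[mv iv] := Lv; apply/L2P; split.
  by apply: measurable_funM.
rewrite (_ : _ \o _ = fun x => ((c ^+ 2)%R%:E * ((v x ^+ 2)%R)%:E)%E).
  exact: integrableZl.
by apply/funext => x /=; rewrite exprMn EFinM.
Qed.

Lemma L2D v w : L2 Omega v -> L2 Omega w -> L2 Omega (fun x => v x + w x).
Proof.
move=> Lv Lw; rewrite /L2 /=.
rewrite (_ : _ \_ _ = v \_ Omega + w \_ Omega).
  have [_ addc] := Lfun_addr_closed mu (lee1n 2 : (1 <= 2%:E)%E); exact: addc.
by apply/funext => x; rewrite fctE /patch; case: ifPn => //; rewrite addr0.
Qed.

Lemma L2N v : L2 Omega v -> L2 Omega (fun x => - v x).
Proof.
by move=> /(L2Z (- 1)); congr (L2 _); apply/funext => x; rewrite mulN1r.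
Qed.

Lemma L2B v w : L2 Omega v -> L2 Omega w -> L2 Omega (fun x => v x - w x).
Proof. by move=> Lv Lw; apply: L2D => //; exact: L2N. Qed.

Lemma L2_sum (I : Type) (r : seq I) (w : I -> E -> R) :
  (forall i, L2 Omega (w i)) -> L2 Omega (fun x => \sum_(i <- r) w i x).
Proof.
move=> Lw; elim: r => [|i r IH].
  rewrite (_ : (fun x => _) = fun x => 0 * 0).
    apply: L2Z; apply/L2P; split; first exact: measurable_cst.
    rewrite (_ : _ \o _ = cst 0%E); first exact: integrable0.
    by apply/funext => x /=; rewrite expr0n.
  by apply/funext => x; rewrite big_nil mul0r.
rewrite (_ : (fun x => _) = fun x => w i x + \sum_(j <- r) w j x).
  exact: L2D.
by apply/funext => x; rewrite big_cons.
Qed.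

Definition ip v w : R := \int[mu]_(x in Omega) (v x * w x).
Definition vip G H : R := \sum_i ip (fun x => G x ord0 i) (fun x => H x ord0 i).
Definition L2v G := forall i, L2 Omega (fun x => G x ord0 i).

Lemma ipC v w : ip v w = ip w v.
Proof. by apply: eq_Rintegral => x _; rewrite mulrC. Qed.

Lemma eq_ip_ae v v' w : L2 Omega v -> L2 Omega v' -> L2 Omega w ->
  ae_on Omega (fun x => v x = v' x) -> ip v w = ip v' w.
Proof.
move=> Lv Lv' Lw vv'; congr fine; apply: ae_eq_integral => //.
- exact: measurable_int (L2_mul_integrable Lv Lw).
- exact: measurable_int (L2_mul_integrable Lv' Lw).
by move: vv'; rewrite /ae_on; apply: filterS => x h Ox /=; rewrite h.
Qed.

Lemma ipDl v v' w : L2 Omega v -> L2 Omega v' -> L2 Omega w ->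
  ip (fun x => v x + v' x) w = ip v w + ip v' w.
Proof.
move=> Lv Lv' Lw; rewrite /ip -RintegralD//; try exact: L2_mul_integrable.
by apply: eq_Rintegral => x _; rewrite mulrDl.
Qed.

Lemma ipZl c v w : L2 Omega v -> L2 Omega w ->
  ip (fun x => c * v x) w = c * ip v w.
Proof.
move=> Lv Lw; rewrite /ip -RintegralZl//; last exact: L2_mul_integrable.
by apply: eq_Rintegral => x _; rewrite mulrA.
Qed.

Lemma ipBl v v' w : L2 Omega v -> L2 Omega v' -> L2 Omega w ->
  ip (fun x => v x - v' x) w = ip v w - ip v' w.
Proof.
move=> Lv Lv' Lw; rewrite /ip -RintegralB//; try exact: L2_mul_integrable.
by apply: eq_Rintegral => x _; rewrite mulrBl.
Qed.

Lemma ip_sumr (I : finType) v (w : I -> E -> R) :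
  L2 Omega v -> (forall i, L2 Omega (w i)) ->
  ip v (fun x => \sum_i w i x) = \sum_i ip v (w i).
Proof.
move=> Lv Lw; rewrite /ip; under eq_Rintegral do rewrite mulr_sumr.
rewrite /Rintegral; under eq_integral => x _ do rewrite -sumEFin.
rewrite integral_sum//; last by move=> i; exact: L2_mul_integrable.
rewrite -sum_fine// => i _; apply: integrable_fin_num => //.
exact: L2_mul_integrable.
Qed.

Lemma ip_ge0 v : 0 <= ip v v.
Proof. by apply: Rintegral_ge0 => x _; rewrite -expr2 sqr_ge0. Qed.

Lemma ip_norm v : ip v v = L2norm Omega v ^+ 2.
Proof. by rewrite L2norm_sqr; apply: eq_Rintegral => x _; rewrite expr2. Qed.

Lemma L2norm_ip v : L2norm Omega v = Num.sqrt (ip v v).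
Proof. by rewrite ip_norm sqrtr_sqr ger0_norm ?L2norm_ge0. Qed.

Lemma ip_addZ v w t : L2 Omega v -> L2 Omega w ->
  ip (fun x => v x + t * w x) (fun x => v x + t * w x) =
  ip v v + 2 * t * ip v w + t ^+ 2 * ip w w.
Proof.
move=> Lv Lw; have Ltw := L2Z t Lw; have Ls := L2D Lv Ltw.
rewrite ipDl// ipZl// (ipC v) (ipC w) !ipDl// !ipZl// (ipC w v); ring.
Qed.

Lemma ip_le v w : L2 Omega v -> L2 Omega w ->
  `|ip v w| <= L2norm Omega v * L2norm Omega w.
Proof.
move=> Lv Lw; rewrite !L2norm_ip.
apply: quadratic_ge0_le; try exact: ip_ge0.
by move=> t; rewrite -ip_addZ//; exact: ip_ge0.
Qed.

Definition vnorm G := L2norm Omega (fun x => enorm (G x)).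

Lemma vnorm_ge0 G : 0 <= vnorm G. Proof. exact: L2norm_ge0. Qed.

Lemma enorm_sqr n (x : 'rV[R]_n) : enorm x ^+ 2 = \sum_i x ord0 i ^+ 2.
Proof. by rewrite sqr_sqrtr// sumr_ge0// => i _; exact: sqr_ge0. Qed.

Lemma vip_norm G : L2v G -> vip G G = vnorm G ^+ 2.
Proof.
move=> LG; rewrite /vnorm L2norm_sqr.
under eq_Rintegral do rewrite enorm_sqr.
rewrite /vip /ip /Rintegral.
under [in RHS]eq_integral => x _ do rewrite -sumEFin.
rewrite integral_sum//; last first.
  by move=> i; have /L2P[] := LG i.
rewrite -sum_fine; last first.
  by move=> i _; apply: integrable_fin_num => //; have /L2P[] := LG i.
by apply: eq_bigr => i _; congr fine; apply: eq_integral => x _; rewrite expr2.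
Qed.

Lemma vnorm_vip G : L2v G -> vnorm G = Num.sqrt (vip G G).
Proof. by move=> LG; rewrite vip_norm// sqrtr_sqr ger0_norm ?vnorm_ge0. Qed.

Lemma vip_addZ G H t : L2v G -> L2v H ->
  vip (fun x => G x + t *: H x) (fun x => G x + t *: H x) =
  vip G G + 2 * t * vip G H + t ^+ 2 * vip H H.
Proof.
move=> LG LH; rewrite /vip !mulr_sumr -!big_split /=; apply: eq_bigr => i _.
rewrite -ip_addZ//; congr ip; apply/funext => x; by rewrite !mxE.
Qed.

Lemma vip_ge0 G : 0 <= vip G G.
Proof. by apply: sumr_ge0 => i _; exact: ip_ge0. Qed.

Lemma vip_le G H : L2v G -> L2v H ->
  `|vip G H| <= vnorm G * vnorm H.
Proof.
move=> LG LH; rewrite !vnorm_vip//.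
apply: quadratic_ge0_le; try exact: vip_ge0.
by move=> t; rewrite -vip_addZ//; exact: vip_ge0.
Qed.

Lemma vip_BB G H : L2v G -> L2v H ->
  vnorm (fun x => G x - H x) ^+ 2 = vnorm G ^+ 2 - 2 * vip G H + vnorm H ^+ 2.
Proof.
move=> LG LH; rewrite -(vip_norm LG) -(vip_norm LH) -vip_norm.
  have -> : (fun x => G x - H x) = (fun x => G x + (- 1) *: H x).
    by apply/funext => x; rewrite scaleN1r.
  by rewrite vip_addZ//; ring.
move=> i; have := L2B (LG i) (LH i); congr (L2 _); apply/funext => x.
by rewrite !mxE.
Qed.

Lemma vnorm0_ae G : L2v G -> vnorm G = 0 -> forall i, ae_on Omega (fun x => G x ord0 i = 0).
Proof.
move=> LG /eqP; rewrite -sqrf_eq0 -vip_norm// => /eqP G0 i.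
have := psumr_eq0P (fun i _ => ip_ge0 (fun x => G x ord0 i)) G0 => /(_ i isT).
rewrite ip_norm L2norm_sqr => i0; have /L2P[mG iG] := LG i.
have : (\int[mu]_(x in Omega) `| (G x ord0 i ^+ 2)%:E | = 0)%E.
  transitivity (\int[mu]_(x in Omega) (EFin \o (fun x => G x ord0 i ^+ 2)%R) x)%E.
    by apply: eq_integral => x _; rewrite gee0_abs// lee_fin sqr_ge0.
  by rewrite -(fineK (integrable_fin_num mO iG)); congr EFin.
move/(ae_eq_integral_abs mu mO (measurable_int _ iG)).
by rewrite /ae_on; apply: filterS => x /[apply] -[] /eqP; rewrite sqrf_eq0 => /eqP.
Qed.

End square_integrable.

(** * Test functions and Green's formula *)

Section test_functions.
Context {R : realType} {d : nat}.
Local Notation E := 'rV[R]_d.+1.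
Local Notation mu := (@lebesgue_rV R d.+1).
Variable Omega : set E.
Hypothesis oO : open Omega.
Hypothesis bO : bounded_set Omega.
Let mO : measurable Omega := open_measurable_rV oO.
Implicit Types (v w phi : E -> R) (G H : E -> E).

Lemma bounded_L2 v M : measurable_fun Omega v ->
  (forall x, Omega x -> `|v x| <= M) -> L2 Omega v.
Proof.
move=> mv vM; apply/(L2P mO); split=> //.
apply: measurable_bounded_integrable => //.
- exact: bounded_lty.
- exact: measurable_funX.
- exists (M ^+ 2); split; first exact: num_real.
  move=> x Mx y Oy; rewrite /= normrX; apply: le_trans (ltW Mx).
  by rewrite lerXn2r ?nnegrE ?vM// (le_trans (normr_ge0 _) (vM _ Oy)).
Qed.

Lemma test_partial i phi : test_function Omega phi ->
  test_function Omega (partial i phi).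
Proof.
move=> [Cphi cphi sphi].
have sub : closure [set x | partial i phi x != 0] `<=` closure [set x | phi x != 0].
  rewrite [X in _ `<=` X](closure_id _).1; last exact: closed_closure.
  apply: closureS => x /=; apply: contra_neqP => xS.
  rewrite /partial.
  have : \forall y \near x, phi y = cst 0 y.
    have : open_nbhs x (~` closure [set x | phi x != 0]).
      by split=> //; rewrite openC; exact: closed_closure.
    move/open_nbhs_nbhs; apply: filterS => y yS; apply/eqP/negPn/negP => y0.
    by apply: yS; exact: subset_closure.
  by move/(near_eq_derive _) => ->; rewrite derive_cst.
split.
- by move=> k; have [_ /(_ i) []] := Cphi k.+1.
- by apply: subclosed_compact sub => //; exact: closed_closure.
- exact: subset_trans sub sphi.
Qed.

Lemma test_continuous phi : test_function Omega phi -> continuous phi.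
Proof. by move=> [/(_ 0%N) []]. Qed.

Lemma test_bounded phi : test_function Omega phi ->
  exists M, forall x, `|phi x| <= M.
Proof.
move=> tphi; have [_ cphi _] := tphi.
have /compact_bounded[M [_ bM]] : compact (phi @` closure [set x | phi x != 0]).
  by apply: continuous_compact => //; apply: continuous_subspaceT; exact: test_continuous.
exists (Num.max 0 (M + 1)) => x.
have [->|x0] := eqVneq (phi x) 0; first by rewrite normr0 le_max lexx.
rewrite le_max; apply/orP; right; apply: bM; first by rewrite ltrDl.
by exists x => //; exact: subset_closure.
Qed.

Lemma test_measurable phi : test_function Omega phi -> measurable_fun setT phi.
Proof. by move/test_continuous; exact: continuous_measurable_rV. Qed.

Lemma test_L2 phi : test_function Omega phi -> L2 Omega phi.
Proof.
move=> tphi; have [M bM] := test_bounded tphi.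
apply: (@bounded_L2 _ M) => //.
by apply: measurable_funTS; exact: test_measurable.
Qed.

Lemma weak_gradP v : sobolev_H1 Omega v -> is_weak_grad Omega v (weak_grad Omega v).
Proof. by move=> [_ [G vG]]; apply: xgetPex; exists G. Qed.

Lemma weak_grad_L2v v : sobolev_H1 Omega v -> L2v Omega (weak_grad Omega v).
Proof. by move=> /weak_gradP vG i; have [] := vG i. Qed.

Lemma weak_laplacianP v : calV Omega v ->
  is_weak_laplacian Omega v (weak_laplacian Omega v).
Proof. by move=> [_ [h vh]]; apply: xgetPex; exists h. Qed.

Lemma weak_laplacian_L2 v : calV Omega v -> L2 Omega (weak_laplacian Omega v).
Proof. by move/weak_laplacianP => -[]. Qed.

Lemma grad_L2v phi : test_function Omega phi -> L2v Omega (grad phi).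
Proof.
move=> tphi i; have := test_L2 (test_partial i tphi); congr (L2 _).
by apply/funext => x; rewrite mxE.
Qed.

Lemma green_test v phi : calV Omega v -> test_function Omega phi ->
  vip Omega (weak_grad Omega v) (grad phi) =
  - ip Omega (weak_laplacian Omega v) phi.
Proof.
move=> vV tphi; have [[Lv _] _] := vV.
have [_ /(_ _ tphi) lapE] := weak_laplacianP vV.
rewrite -[X in - X]lapE.
rewrite /vip (eq_bigr (fun i => - ip Omega v (partial i (partial i phi)))).
  rewrite sumrN; congr (- _).
  rewrite /laplacian -[RHS]/(ip Omega v (fun x => \sum_i partial i (partial i phi) x)).
  have Li i : L2 Omega (partial i (partial i phi)).
    by apply: test_L2; do 2 apply: test_partial.
  by rewrite ip_sumr.
move=> i _.
have [_ /(_ _ (test_partial i tphi)) gE] := weak_gradP vV.1 i.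
rewrite (gE : ip Omega v (partial i (partial i phi)) = _).
rewrite opprK; apply: eq_Rintegral => x _; by rewrite mxE.
Qed.

Lemma eps_eq0 (a K : R) : 0 <= K -> (forall e, 0 < e -> `|a| <= K * e) -> a = 0.
Proof.
move=> K0 h; apply/eqP; rewrite -normr_le0; apply/ler_addgt0Pl => e e0.
rewrite addr0; have K1 : 0 < K + 1 by lra.
apply: le_trans (h (e / (K + 1)) _) _; first exact: divr_gt0.
rewrite mulrCA ler_piMr ?(ltW e0)// ler_pdivrMr//; lra.
Qed.

(** Both sides are continuous in u for the norm of H^1, and they agree on test
    functions, of which u is a limit. *)
Lemma green_H10 v u : calV Omega v -> sobolev_H10 Omega u ->
  vip Omega (weak_grad Omega v) (weak_grad Omega u) =
  - ip Omega (weak_laplacian Omega v) u.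
Proof.
move=> vV [uH1 dense]; apply/eqP; rewrite -subr_eq0 opprK; apply/eqP.
set G := weak_grad Omega v; set H := weak_grad Omega u.
set h := weak_laplacian Omega v.
have LG : L2v Omega G := weak_grad_L2v vV.1.
have LH : L2v Omega H := weak_grad_L2v uH1.
have Lh : L2 Omega h := weak_laplacian_L2 vV.
have Lu : L2 Omega u := uH1.1.
apply: (@eps_eq0 _ (vnorm Omega G + L2norm Omega h)).
  by rewrite addr_ge0 ?vnorm_ge0 ?L2norm_ge0.
move=> e /dense[phi [tphi ue He]].
have Lp := test_L2 tphi; have Lgp := grad_L2v tphi.
have LHp : L2v Omega (fun x => H x - grad phi x).
  move=> i; have := L2B mO (LH i) (Lgp i); congr (L2 _).
  by apply/funext => x; rewrite !mxE.
have Lup := L2B mO Lu Lp.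
have -> : vip Omega G H + ip Omega h u =
    vip Omega G (fun x => H x - grad phi x) + ip Omega h (fun x => u x - phi x).
  rewrite (ipC _ h (fun x => u x - phi x)) (ipBl mO Lu Lp Lh) !(ipC _ _ h).
  rewrite (_ : vip Omega G (fun x => H x - grad phi x) = vip Omega G H - vip Omega G (grad phi)).
    by rewrite (green_test vV tphi) -/h; ring.
  rewrite /vip -sumrB; apply: eq_bigr => i _.
  rewrite !(ipC _ (fun x => G x _ _)) -(ipBl mO (LH i) (Lgp i) (LG i)).
  by congr ip; apply/funext => x; rewrite !mxE.
apply: le_trans (ler_normD _ _) _; rewrite mulrDl lerD//.
  by apply: le_trans (vip_le mO LG LHp) _; rewrite ler_wpM2l ?vnorm_ge0// ltW.
by apply: le_trans (ip_le mO Lh Lup) _; rewrite ler_wpM2l ?L2norm_ge0// ltW.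
Qed.

End test_functions.

(** * Comparison of the functionals *)

Section comparison.
Context {R : realType} {d : nat}.
Local Notation E := 'rV[R]_d.+1.
Local Notation mu := (@lebesgue_rV R d.+1).
Variables (Omega : set E) (f u : E -> R) (C : R).
Hypothesis oO : open Omega.
Hypothesis bO : bounded_set Omega.
Hypotheses (Lf : L2 Omega f) (uV : calV Omega u) (uH : sobolev_H10 Omega u).
Hypothesis uf : ae_on Omega (fun x => - weak_laplacian Omega u x = f x).
Hypothesis C0 : 0 < C.
Hypothesis CPC : (C_P Omega < C%:E)%E.
Let mO : measurable Omega := open_measurable_rV oO.

Let Gu := weak_grad Omega u.
Let LGu : L2v Omega Gu := weak_grad_L2v uV.1.
Let Lu : L2 Omega u := uV.1.1.

(** The quotient of norms in the definition of [C_P] has value 0 when its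
    denominator vanishes, so the supremum bounds the L^2 norm of u only if the
    seminorm of u is nonzero. *)
Lemma poincare_lt : vnorm Omega Gu != 0 ->
  exists c, [/\ 0 <= c, c < C & L2norm Omega u <= c * vnorm Omega Gu].
Proof.
move=> N0; have [u0|nu0] := pselect (ae_on Omega (fun x => u x = 0)).
  exists 0; split => //; rewrite mul0r.
  have -> : L2norm Omega u = L2norm Omega (cst 0).
    apply: (eq_L2norm_ae mO) => //; exact: (L2_measurable mO Lu).
  by rewrite (L2norm0 mO).
exists (L2norm Omega u / vnorm Omega Gu); split.
- by rewrite divr_ge0 ?L2norm_ge0 ?vnorm_ge0.
- rewrite -lte_fin; apply: le_lt_trans CPC; apply: ereal_sup_ubound.
  by exists u.
- by rewrite divfK.
Qed.

Let D v := L2norm Omega (fun x => weak_laplacian Omega v x + f x).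

Lemma residual_L2 v : calV Omega v ->
  L2 Omega (fun x => weak_laplacian Omega v x + f x).
Proof. by move=> vV; exact: (L2D (weak_laplacian_L2 vV) Lf). Qed.

Lemma residual_u0 : D u = 0.
Proof.
have -> : D u = L2norm Omega (cst 0).
  apply: (eq_L2norm_ae mO) => //.
    exact: (L2_measurable mO (residual_L2 uV)).
  by move: uf; rewrite /ae_on; apply: filterS => x h Ox; rewrite -h// subrr.
exact: (L2norm0 mO).
Qed.

Lemma energy_identity v : calV Omega v ->
  vnorm Omega Gu ^+ 2 - vip Omega (weak_grad Omega v) Gu =
  ip Omega (fun x => weak_laplacian Omega v x + f x) u.
Proof.
move=> vV; rewrite -(vip_norm mO LGu) !(green_H10 oO bO)//.
rewrite (ipDl mO (weak_laplacian_L2 vV) Lf Lu).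
suff -> : ip Omega (weak_laplacian Omega u) u = - ip Omega f u by ring.
have LLu := weak_laplacian_L2 uV.
have := ip_le mO (residual_L2 uV) Lu; rewrite -/(D u) residual_u0 mul0r.
rewrite normr_le0 (ipDl mO LLu Lf Lu) addr_eq0 => /eqP; exact.
Qed.

(** Cauchy-Schwarz and the Poincare inequality bound the energy identity by
    |u|_1^2 <= |v|_1 |u|_1 + c ||Delta v + f||_0 |u|_1, which is then divided by
    |u|_1. *)
Lemma seminorm_le v : calV Omega v -> vnorm Omega Gu != 0 ->
  exists2 c, 0 <= c < C &
    vnorm Omega Gu <= vnorm Omega (weak_grad Omega v) + c * D v.
Proof.
move=> vV N0; have [c [c0 cC uc]] := poincare_lt N0; exists c; first by rewrite c0.
have LGv := weak_grad_L2v vV.1.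
have Ngt0 : 0 < vnorm Omega Gu by rewrite lt_neqAle eq_sym N0 vnorm_ge0.
rewrite -(ler_pM2r Ngt0).
have := ler_norm (ip Omega (fun x => weak_laplacian Omega v x + f x) u).
move=> /le_trans/(_ (ip_le mO (residual_L2 vV) Lu)).
rewrite -energy_identity// -/(D v) => h1.
have h2 := le_trans (ler_norm _) (vip_le mO LGv LGu).
have h3 : D v * L2norm Omega u <= D v * (c * vnorm Omega Gu).
  by rewrite ler_wpM2l ?L2norm_ge0.
move: h1 h2 h3; rewrite expr2 mulrDl.
set N := vnorm _ Gu; set V := vnorm _ _; set S := vip _ _ _; lra.
Qed.

Lemma J_uE : J Omega f C u = vnorm Omega Gu.
Proof. by rewrite /J -/(D u) residual_u0 mulr0 add0r. Qed.

Lemma J_min v : calV Omega v -> J Omega f C u <= J Omega f C v.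
Proof.
move=> vV; rewrite J_uE /J -/(D v) -[H1_seminorm _ _]/(vnorm _ _) addrC.
have D0 : 0 <= D v by exact: L2norm_ge0.
have [->|N0] := eqVneq (vnorm Omega Gu) 0.
  by rewrite addr_ge0 ?vnorm_ge0// mulr_ge0// ltW.
have [c /andP[c0 cC] /le_trans] := seminorm_le vV N0; apply.
by rewrite lerD2l ler_wpM2r// ltW.
Qed.

(** Equality forces the residual of v to vanish because c < C; then
    <grad v, grad u> = |u|_1^2 = |v|_1^2, and |v - u|_1 = 0 by expansion. *)
Lemma J_eq_grad v : calV Omega v -> J Omega f C v = J Omega f C u ->
  forall i, ae_on Omega (fun x => weak_grad Omega v x ord0 i = Gu x ord0 i).
Proof.
move=> vV; rewrite J_uE /J -/(D v) -[H1_seminorm _ _]/(vnorm _ _).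
set Gv := weak_grad Omega v => Jvu.
have LGv : L2v Omega Gv := weak_grad_L2v vV.1.
have D0 : 0 <= D v by exact: L2norm_ge0.
have V0 : 0 <= vnorm Omega Gv by exact: vnorm_ge0.
suff GvGu : vnorm Omega (fun x => Gv x - Gu x) = 0.
  have LB : L2v Omega (fun x => Gv x - Gu x).
    move=> i; have := L2B mO (LGv i) (LGu i); congr (L2 _).
    by apply/funext => x; rewrite !mxE.
  move=> i; have := vnorm0_ae mO LB GvGu i; rewrite /ae_on; apply: filterS.
  by move=> x h /h; rewrite !mxE => /eqP; rewrite subr_eq0 => /eqP.
apply/eqP; rewrite -sqrf_eq0 (vip_BB mO LGv LGu).
have [N0|N0] := eqVneq (vnorm Omega Gu) 0.
  have VV : vnorm Omega Gv = 0.
    apply/eqP; rewrite eq_le V0 andbT -N0 -Jvu lerDr mulr_ge0// ltW//.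
  have := vip_le mO LGv LGu; rewrite VV mul0r normr_le0 => /eqP ->.
  by rewrite N0 mulr0 expr0n !(subr0, addr0).
have [c /andP[c0 cC]] := seminorm_le vV N0; rewrite -/Gv => NV.
have DE : D v = 0.
  apply/eqP; rewrite eq_le D0 andbT -(@pmulr_rle0 _ (C - c)) ?subr_gt0//.
  by rewrite mulrBl subr_le0 -(lerD2r (vnorm Omega Gv)) Jvu addrC.
have := ip_le mO (residual_L2 vV) Lu; rewrite -/(D v) DE mul0r normr_le0.
rewrite -energy_identity// subr_eq0 => /eqP <-.
by rewrite -Jvu DE mulr0 add0r; apply/eqP; ring.
Qed.

End comparison.

(** * The integral of a derivative *)

Section integral_partial.
Context {R : realType} {d : nat}.
Local Notation E := 'rV[R]_d.+1.
Local Notation mu := (@lebesgue_rV R d.+1).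
Implicit Types (phi : E -> R).

Lemma derivable_line phi (x e : E) (s : R) :
  derivable phi (s *: e + x) e ->
  is_derive s 1 (fun t : R => phi (t *: e + x)) ('D_e phi (s *: e + x)).
Proof.
move=> dphi.
have qE : (fun h : R => h^-1 *: (((fun t : R => phi (t *: e + x)) \o shift s) (h *: (1 : R))
      - phi (s *: e + x))) =
    (fun h => h^-1 *: ((phi \o shift (s *: e + x)) (h *: e) - phi (s *: e + x))).
  apply/funext => h /=; congr (_ *: (phi _ - _)).
  by rewrite addrA -scalerDl; congr (_ *: _ + _); rewrite /GRing.scale /= mulr1.
by split; rewrite /derivable /derive /= qE.
Qed.

(** By the mean value theorem along the line x + R e; this bound makes dominated
    convergence applicable to difference quotients. *)
Lemma diff_quotient_le phi (e : E) (M t : R) (x : E) : 0 < t ->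
  (forall y, derivable phi y e) -> (forall y, `|'D_e phi y| <= M) ->
  `|t^-1 * (phi (t *: e + x) - phi x)| <= M.
Proof.
move=> t0 dphi bM.
pose g := fun s : R => phi (s *: e + x).
have dg (s : R) : is_derive s (1 : R) g ('D_e phi (s *: e + x)) by exact: derivable_line.
have [s _] : exists2 s, s \in `[0, t]%R & g t - g 0 = 'D_e phi (s *: e + x) * (t - 0).
  apply: (@MVT_segment _ g (fun s => 'D_e phi (s *: e + x))) => //; first exact: ltW.
  apply: continuous_subspaceT => y.
  exact/differentiable_continuous/derivable1_diffP/ex_derive.
rewrite /g scale0r add0r subr0 => ->.
by rewrite mulrCA mulVf ?gt_eqF// mulr1.
Qed.

Lemma cvg_harmonic_dnbhs : @harmonic R @ \oo --> 0^'.
Proof.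
move=> A; rewrite /dnbhs /= => hA.
have hB : nbhs (0:R) (fun y => y != 0 -> A y) by exact: hA.
have : \forall n \near \oo, @harmonic R n != 0 -> A (@harmonic R n) by exact: cvg_harmonic hB.
by apply: filterS => n; apply; rewrite gt_eqF// harmonic_gt0.
Qed.

Lemma integrable_indicZ (M : R) (B : set E) : measurable B -> (mu B < +oo)%E ->
  mu.-integrable setT (EFin \o (fun x => M * \1_B x)).
Proof.
move=> mB muB.
rewrite (_ : _ \o _ = fun x => (M%:E * (EFin \o \1_B) x)%E)//.
apply: integrableZl => //; apply/integrableP; split.
  exact/measurable_EFinP/measurable_indic.
rewrite (eq_integral (fun x => (\1_B x)%:E)); last first.
  by move=> x _; rewrite gee0_abs// lee_fin.
by rewrite integral_indic// setIT.
Qed.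

(** By translation invariance every difference quotient of phi has integral zero;
    the quotients converge boundedly to the derivative, with supports in a fixed
    ball. *)
Lemma integral_partial0 phi i (M : R) : continuous phi ->
  (forall y, derivable phi y (delta_mx ord0 i)) -> continuous (partial i phi) ->
  bounded_set [set x | phi x != 0] ->
  (forall x, `|phi x| <= M) -> (forall x, `|partial i phi x| <= M) ->
  \int[mu]_x partial i phi x = 0.
Proof.
move=> cphi dphi cdphi [K0 [_ bK]] phiM dphiM.
set e : E := delta_mx ord0 i; set K := K0 + 1.
have phi0 x : phi x != 0 -> `|x| <= K by move=> px; apply: bK => //; rewrite /K ltrDl.
have M0 : 0 <= M by exact: le_trans (normr_ge0 _) (phiM 0).
have e1 : `|e| <= 1.
  rewrite [leLHS]/Num.norm /= mx_normrE; apply/bigmax_leP; split => //= -[a b] _ /=.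
  by rewrite mxE; case: (_ && _); rewrite ?normr1 ?normr0.
(* Translations by at most e keep the support of phi, of radius K, inside B. *)
pose B : set E := ball 0 (K + 2).
have mB : measurable B by apply: open_measurable_rV; exact: ball_open.
have BE x : B x = (`|x| < K + 2) by rewrite /B -ball_normE /= sub0r normrN.
have muB : (mu B < +oo)%E.
  apply: bounded_lty => //; exists (K + 2); split; first exact: num_real.
  move=> r Kr x.
  by rewrite BE => /ltW /le_trans; apply; exact: ltW.
pose g : E -> R := fun x => M * \1_B x.
have ig : mu.-integrable setT (EFin \o g) by exact: integrable_indicZ.
have mphi := continuous_measurable_rV cphi.
have phi_g x : `|phi x| <= g x.
  rewrite /g indicE; case: (boolP (x \in B)) => [_|]; first by rewrite mulr1.
  rewrite notin_setE BE => /negP; rewrite -leNgt => xK.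
  have [->|/phi0 h] := eqVneq (phi x) 0; first by rewrite normr0 mulr0.
  by exfalso; lra.
have iphi : mu.-integrable setT (EFin \o phi).
  apply: le_integrable ig => //; first exact/measurable_EFinP.
  move=> x _; rewrite /= lee_fin; apply: le_trans (phi_g x) _; exact: ler_norm.
pose tau (n : nat) (x : E) : R := phi (@harmonic R n *: e + x).
pose f (n : nat) (x : E) : R := (@harmonic R n)^-1 * (tau n x - phi x).
have tauE n : tau n = (fun x => phi (x + @harmonic R n *: e)).
  by apply/funext => x; rewrite addrC.
have h01 n : 0 < @harmonic R n <= 1.
  by rewrite harmonic_gt0 /= invf_le1// ler1n.
have itau n : mu.-integrable setT (EFin \o tau n).
  by have [h1 _] := integral_translate (@harmonic R n *: e) iphi; rewrite tauE.
have Etau n : \int[mu]_x tau n x = \int[mu]_x phi x.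
  have [_ h2] := integral_translate (@harmonic R n *: e) iphi.
  by rewrite tauE /Rintegral -h2.
have idiff n : mu.-integrable setT (EFin \o (tau n \- phi)).
  exact: (integrableB measurableT (itau n) iphi).
have if_ n : (\int[mu]_x (EFin \o f n) x = 0)%E.
  have fi : mu.-integrable setT (EFin \o f n).
    rewrite (_ : _ \o _ = fun x : E => (((@harmonic R n)^-1)%R%:E *
      (EFin \o (tau n \- phi)%R) x)%E)//.
    exact: integrableZl.
  rewrite -(fineK (integrable_fin_num measurableT fi)); congr EFin.
  transitivity (\int[mu]_x f n x) => //.
  have d0 : \int[mu]_x (tau n \- phi) x = 0.
    by rewrite (@RintegralB _ _ _ mu setT (tau n) phi)// Etau subrr.
  by rewrite (@RintegralZl _ _ _ mu setT (tau n \- phi))// d0 mulr0.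
have mf n : measurable_fun setT (f n).
  apply: measurable_funM => //; apply: measurable_funB => //.
  by have /measurable_int/measurable_EFinP := itau n.
have [] := @dominated_convergence _ _ _ mu setT measurableT (fun n => EFin \o f n)
   (EFin \o partial i phi) (EFin \o g).
- by move=> n; exact/measurable_EFinP.
- by apply/measurable_EFinP; exact: (continuous_measurable_rV cdphi).
- apply: nearW => x _; apply: cvg_EFin; first exact: nearW.
  have := dphi x; rewrite /derivable => /cvg_ex[l hl].
  have -> : partial i phi x = l by apply: cvg_lim hl.
  exact: (cvg_comp _ _ cvg_harmonic_dnbhs hl).
- exact: ig.
- apply: nearW => x n _ /=; rewrite lee_fin.
  rewrite /g indicE; case: (boolP (x \in B)) => [_|].
    rewrite mulr1; apply: diff_quotient_le => //.
    by have /andP[] := h01 n.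
  rewrite notin_setE BE => /negP; rewrite -leNgt => xK.
  have z y : K < `|y| -> phi y = 0.
    by move=> Ky; apply/eqP/negPn/negP => /phi0; rewrite leNgt Ky.
  rewrite /f /tau !z ?subrr ?mulr0 ?normr0//; first by lra.
  have : `|x| <= `|@harmonic R n *: e + x| + 1.
    rewrite -[x in leLHS](addKr (@harmonic R n *: e)) addrC.
    apply: le_trans (ler_normB _ _) _; rewrite lerD2l normrZ.
    have /andP[h0 h1] := h01 n.
    by rewrite ger0_norm ?(ltW h0)// mulr_ile1 ?(ltW h0).
  by lra.
move=> _ _; rewrite (_ : (fun n => _) = cst 0%E); last first.
  by apply/funext => n; exact: if_.
move=> /cvg_lim => /(_ (@ereal_hausdorff R)).
by rewrite lim_cst; [rewrite /Rintegral => <-|exact: ereal_hausdorff].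
Qed.

End integral_partial.

(** * Invariance under additive constants *)

Section constant_shift.
Context {R : realType} {d : nat}.
Local Notation E := 'rV[R]_d.+1.
Local Notation mu := (@lebesgue_rV R d.+1).
Variable Omega : set E.
Hypothesis oO : open Omega.
Hypothesis bO : bounded_set Omega.
Let mO : measurable Omega := open_measurable_rV oO.
Implicit Types (v w phi : E -> R).

Lemma test_eq0 phi x : test_function Omega phi -> ~ Omega x -> phi x = 0.
Proof.
move=> [_ _ sphi] nOx; apply/eqP/negPn/negP => px; apply: nOx; apply: sphi.
exact: subset_closure.
Qed.

Lemma integral_test_partial phi i : test_function Omega phi ->
  \int[mu]_(x in Omega) partial i phi x = 0.
Proof.
move=> tphi; have tdphi := test_partial i tphi.
rewrite Rintegral_mkcond (_ : _ \_ _ = partial i phi); last first.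
  apply/funext => x; rewrite /patch; case: ifPn => // /negP; rewrite inE => nOx.
  by rewrite (test_eq0 tdphi nOx).
have [M bM] := test_bounded tphi; have [M' bM'] := test_bounded tdphi.
apply: (@integral_partial0 _ _ phi i (Num.max M M')).
- exact: (test_continuous tphi).
- by have [/(_ 1%N) [_ /(_ i) []]] := tphi.
- exact: (test_continuous tdphi).
- have [_ /compact_bounded[K [Kr bK]] _] := tphi.
  by exists K; split => // r Kr' x px; apply: bK => //; exact: subset_closure.
- by move=> x; rewrite le_max bM.
- by move=> x; rewrite le_max bM' orbT.
Qed.

Lemma L2_cst c : L2 Omega (cst c).
Proof. by apply: (bounded_L2 oO bO (M := `|c|)) => //; exact: measurable_cst. Qed.

Lemma integral_shift v w c psi : L2 Omega v -> L2 Omega w ->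
  ae_on Omega (fun x => v x - w x = c) -> L2 Omega psi ->
  \int[mu]_(x in Omega) psi x = 0 ->
  \int[mu]_(x in Omega) (v x * psi x) = \int[mu]_(x in Omega) (w x * psi x).
Proof.
move=> Lv Lw vw Lpsi psi0.
have Lc := L2_cst c; have Lwc : L2 Omega (fun x => w x + cst c x) := L2D Lw Lc.
transitivity (ip Omega (fun x => w x + cst c x) psi).
  apply: (eq_ip_ae mO Lv Lwc Lpsi); move: vw; rewrite /ae_on.
  by apply: filterS => x h Ox; rewrite /= -(h Ox); ring.
rewrite (ipDl mO Lw Lc Lpsi).
suff -> : ip Omega (cst c) psi = 0 by rewrite addr0.
have -> : ip Omega (cst c) psi = ip Omega (fun x => c * cst 1 x) psi.
  by congr ip; apply/funext => x; rewrite /= mulr1.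
rewrite (ipZl mO _ (L2_cst 1) Lpsi) /ip.
under eq_Rintegral do rewrite mul1r.
by rewrite psi0 mulr0.
Qed.

Lemma is_weak_grad_shift v w c : L2 Omega v -> L2 Omega w ->
  ae_on Omega (fun x => v x - w x = c) ->
  is_weak_grad Omega v = is_weak_grad Omega w.
Proof.
move=> Lv Lw vw; apply/funext => G; apply/propext.
have tE i phi : test_function Omega phi ->
    \int[mu]_(x in Omega) (v x * partial i phi x) =
    \int[mu]_(x in Omega) (w x * partial i phi x).
  move=> tphi; apply: (integral_shift Lv Lw vw).
    exact/(test_L2 oO bO)/test_partial.
  exact: integral_test_partial.
by split => h i; have [h1 h2] := h i; split => // phi tphi;
  have := h2 phi tphi; rewrite tE.
Qed.

Lemma test_laplacian phi : test_function Omega phi ->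
  L2 Omega (laplacian phi) /\ \int[mu]_(x in Omega) laplacian phi x = 0.
Proof.
move=> tphi.
have ti i : test_function Omega (partial i (partial i phi)) by do 2 apply: test_partial.
have Li i := test_L2 oO bO (ti i).
have L1 : L2 Omega (cst 1) := L2_cst 1.
split; first exact: (L2_sum mO).
transitivity (ip Omega (cst 1) (laplacian phi)).
  by apply: eq_Rintegral => x _; rewrite mul1r.
rewrite /laplacian (ip_sumr mO L1 Li) big1// => i _.
rewrite /ip; under eq_Rintegral do rewrite mul1r.
exact/integral_test_partial/test_partial.
Qed.

Lemma is_weak_laplacian_shift v w c : L2 Omega v -> L2 Omega w ->
  ae_on Omega (fun x => v x - w x = c) ->
  is_weak_laplacian Omega v = is_weak_laplacian Omega w.
Proof.
move=> Lv Lw vw; apply/funext => h; apply/propext.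
have tE phi : test_function Omega phi ->
    \int[mu]_(x in Omega) (v x * laplacian phi x) =
    \int[mu]_(x in Omega) (w x * laplacian phi x).
  by move=> /test_laplacian[? ?]; exact: (integral_shift Lv Lw vw).
by split => -[h1 h2]; split => // phi tphi; have := h2 phi tphi; rewrite tE.
Qed.

(** The representatives of the weak derivatives are chosen from the sets of all
    candidates, and these sets are equal for v and w; so the representatives are
    the same functions. *)
Lemma J_shift f C v w c : L2 Omega v -> L2 Omega w ->
  ae_on Omega (fun x => v x - w x = c) -> J Omega f C v = J Omega f C w.
Proof.
move=> Lv Lw vw; rewrite /J /H1_seminorm /weak_laplacian /weak_grad.
by rewrite (is_weak_grad_shift Lv Lw vw) (is_weak_laplacian_shift Lv Lw vw).
Qed.

End constant_shift.

(** * Smooth functions *)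

Section Ck_along.
Context {R : realType} {V : normedModType R} {I : Type} (e : I -> V).
Implicit Types (f g : V -> R).

(** The directions e are a parameter so that functions of one variable (one
    direction) and functions of a vector (the canonical basis) are treated at
    once; for the canonical basis this is [Ck]. *)
Fixpoint Ck_along (k : nat) f : Prop :=
  continuous f /\
  if k is k'.+1 then
    forall i, (forall x, derivable f x (e i)) /\ Ck_along k' (fun x => 'D_(e i) f x)
  else True.

Lemma eq_Ck_along f g k : f =1 g -> Ck_along k f -> Ck_along k g.
Proof. by move=> /funext ->. Qed.

Lemma Ck_alongS k f : Ck_along k.+1 f -> Ck_along k f.
Proof.
elim: k f => [|k IH] f [cf df]; first by [].
by split=> // i; have [? ?] := df i; split => //; exact: IH.
Qed.

Lemma Ck_along_cst k (c : R) : Ck_along k (fun=> c).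
Proof.
elim: k c => [|k IH] c; split => //; try by move=> x; exact: cvg_cst.
move=> i; split; first by move=> x; exact: derivable_cst.
by apply: eq_Ck_along (IH 0) => x; rewrite derive_cst.
Qed.

Lemma Ck_alongD k f g : Ck_along k f -> Ck_along k g ->
  Ck_along k (fun x => f x + g x).
Proof.
elim: k f g => [|k IH] f g [cf df] [cg dg]; split=> //;
  try by move=> x; apply: cvgD; [exact: cf|exact: cg].
move=> i; have [df1 df2] := df i; have [dg1 dg2] := dg i.
split; first by move=> x; exact: (derivableD (df1 x) (dg1 x)).
by apply: eq_Ck_along (IH _ _ df2 dg2) => x; rewrite (deriveD (df1 x) (dg1 x)).
Qed.

Lemma Ck_alongM k f g : Ck_along k f -> Ck_along k g ->
  Ck_along k (fun x => f x * g x).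
Proof.
elim: k f g => [|k IH] f g Hf Hg; have [cf df] := Hf; have [cg dg] := Hg;
  split=> //; try by move=> x; apply: cvgM; [exact: cf|exact: cg].
move=> i; have [df1 df2] := df i; have [dg1 dg2] := dg i.
split; first by move=> x; exact: (derivableM (df1 x) (dg1 x)).
apply: eq_Ck_along (Ck_alongD (IH _ _ (Ck_alongS Hf) dg2) (IH _ _ (Ck_alongS Hg) df2)).
by move=> x; rewrite (deriveM (df1 x) (dg1 x)).
Qed.

Lemma Ck_along_prod (J : finType) k (f : J -> V -> R) :
  (forall j, Ck_along k (f j)) -> Ck_along k (fun x => \prod_j f j x).
Proof.
move=> Cf; elim: (index_enum J) => [|j r IH].
  by apply: eq_Ck_along (Ck_along_cst k 1) => x; rewrite big_nil.
by apply: eq_Ck_along (Ck_alongM (Cf j) IH) => x; rewrite big_cons.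
Qed.

Lemma Ck_alongV k f : (forall x, f x != 0) -> Ck_along k f ->
  Ck_along k (fun x => (f x)^-1).
Proof.
move=> f0; elim: k => [|k IH] Hf; have [cf df] := Hf;
  split=> //; try by move=> x; apply: cvgV => //; exact: cf.
move=> i; have [df1 df2] := df i.
split; first by move=> x; exact: (derivableV (f0 x) (df1 x)).
have IH' := IH (Ck_alongS Hf).
apply: eq_Ck_along (Ck_alongM (Ck_along_cst k (-1)) (Ck_alongM (Ck_alongM IH' IH') df2)).
move=> x; rewrite (deriveV (f0 x) (df1 x)).
by rewrite /GRing.scale /= mulN1r -mulNr -expr2 exprVn.
Qed.

End Ck_along.

Definition smooth {R : realType} (f : R -> R) :=
  forall k, Ck_along (fun _ : unit => (1 : R)) k f.

Section composition.
Context {R : realType} {V : normedModType R} {I : Type} (e : I -> V).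

(** The functions L met below are the coordinates of a vector and the affine maps
    of the line. *)
Lemma derive_affine (f : R -> R) (L : V -> R) (v x : V) (c : R) :
  (forall h y, L (h *: v + y) = h * c + L y) -> derivable f (L x) 1 ->
  is_derive x v (fun y => f (L y)) (c * 'D_1 f (L x)).
Proof.
move=> LE df; have dif : differentiable f (L x) by exact/derivable1_diffP.
have qE : (fun h => h^-1 *: (((fun y => f (L y)) \o shift x) (h *: v) - f (L x))) =
          (fun h => h^-1 *: ((f \o shift (L x)) (h *: c) - f (L x))).
  by apply/funext => h /=; rewrite LE.
split; first by rewrite /derivable /= qE; exact: diff_derivable.
transitivity ('D_c f (L x)); first by rewrite /derive /= qE.
by rewrite !deriveE// -[in LHS](mulr1 c) -[c * 1]/(c *: (1 : R)) linearZ.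
Qed.

Lemma Ck_along_affine k (f : R -> R) (L : V -> R) (c : I -> R) :
  continuous L -> (forall i h y, L (h *: e i + y) = h * c i + L y) ->
  Ck_along (fun _ : unit => (1 : R)) k f -> Ck_along e k (fun x => f (L x)).
Proof.
move=> cL LE; elim: k f => [|k IH] f [cf df]; split => //;
  try by move=> x; apply: (@continuous_comp _ _ _ L f); [exact: cL|exact: cf].
move=> i; have [df1 df2] := df tt.
have dfL x := derive_affine (LE i) (df1 (L x)).
split; first by move=> x; have [] := dfL x.
apply: eq_Ck_along (Ck_alongM (Ck_along_cst e k (c i)) (IH _ df2)).
by move=> x; have [] := dfL x.
Qed.

End composition.

Section flat.
Context {R : realType}.
Implicit Types (x : R) (m : nat).

(** The derivative of x^(-m) exp(-1/x) is a combination of functions of the same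
    form, so this family, and not only its member m = 0, is used to prove
    smoothness by induction. *)
Definition flat m x : R := if 0 < x then x^-1 ^+ m * expR (- x^-1) else 0.

Lemma flat_ge0 m x : 0 <= flat m x.
Proof.
rewrite /flat; case: ifPn => // x0.
by rewrite mulr_ge0 ?expR_ge0// exprn_ge0// invr_ge0 ltW.
Qed.

(** From exp y >= y^(m+1) / (m+1)! with y = 1/x. *)
Lemma flat_le m x : flat m x <= m.+1`!%:R * `|x|.
Proof.
rewrite /flat; case: ifPn => x0; last by rewrite mulr_ge0.
have xV : 0 < x^-1 by rewrite invr_gt0.
rewrite gtr0_norm// expRN -[leRHS]mulr1 ler_pdivrMr ?expR_gt0// mulr1.
have := expR_ge1Dxn m (ltW xV) => h.
apply: (@le_trans _ _ (m.+1`!%:R * x * (x^-1 ^+ m.+1 / m.+1`!%:R))).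
  have F0 : (m.+1`!%:R : R) != 0 by rewrite pnatr_eq0 -lt0n fact_gt0.
  move: F0; set F : R := _%:R; set b := x^-1 ^+ m => F0.
  have -> : F * x * (x^-1 ^+ m.+1 / F) = b.
    by rewrite exprS -/b; field; rewrite F0 gt_eqF.
  by [].
rewrite ler_wpM2l ?mulr_ge0 ?(ltW x0)//.
by apply: le_trans h; rewrite lerDr.
Qed.

Lemma flat_cvg0 m : flat m x @[x --> 0^'] --> (0 : R).
Proof.
apply: (@squeeze_cvgr _ _ _ _ (fun=> 0) (fun x => m.+1`!%:R * `|x|)).
- by apply: nearW => x; rewrite flat_ge0 flat_le.
- exact: cvg_cst.
- rewrite -[X in _ --> X](mulr0 m.+1`!%:R).
  apply: cvgM; first exact: cvg_cst.
  apply: cvg_within_filter.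
  have : `|x| @[x --> (0:R)] --> `|0 : R| by apply: cvg_norm; exact: cvg_id.
  by rewrite normr0.
Qed.

Lemma is_derive_flat m x :
  is_derive x (1 : R) (flat m) (flat m.+2 x - m%:R * flat m.+1 x).
Proof.
have [x0|x0|x0] := ltgtP x 0.
- apply: (@near_eq_is_derive _ _ _ (cst 0 : R -> R)).
    near=> y; rewrite /flat ltNge ltW//=.
    by near: y; exact: lt_nbhsl.
  by rewrite /flat !ltNge !ltW//= mulr0 subr0; exact: is_derive_cst.
- pose h : R -> R := (fun y => y^-1) ^+ m * (expR \o (- (fun y : R => y^-1))).
  apply: (@near_eq_is_derive _ _ _ h).
    near=> y; have y0 : 0 < y by near: y; exact: lt_nbhsr.
    by rewrite /flat y0 /h fctE exprfctE.
  have xn0 : x != 0 by rewrite gt_eqF.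
  have dV : is_derive x (1 : R) (fun y : R => y^-1) (- x ^- 2).
    by apply: is_derive_eq (@is_deriveV _ id x _ _ xn0 _) _; rewrite /GRing.scale /= mulr1.
  have dE := @is_derive1_comp _ expR (- (fun y : R => y^-1)) x _ _ (is_derive_expR _) (is_deriveN dV).
  apply: is_derive_eq (is_deriveM (is_deriveX m dV) dE) _.
  rewrite /flat x0 /= exprfctE /GRing.scale /= ?fctE.
  by rewrite -exprVn; case: m {h} => [|k]; rewrite /= !exprS; ring.
- rewrite x0.
  have f0 k : flat k (0 : R) = 0 by rewrite /flat ltxx.
  rewrite !f0 mulr0 subr0.
  have c0 : (fun h : R => h^-1 *: ((flat m \o shift 0) (h *: (1 : R)) - flat m 0)) @ 0^'
      --> (0 : R).
    (* The difference quotient of flat m at 0 is flat m.+1. *)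
    rewrite (_ : (fun h => _) = flat m.+1); first exact: flat_cvg0.
    apply/funext => h; rewrite f0 subr0 /= addr0 /GRing.scale /= mulr1 /flat.
    by case: ifP => _; rewrite ?mulr0// mulrA -exprS.
  split; first by apply/cvg_ex; exists 0.
  exact: cvg_lim c0.
Unshelve. all: end_near.
Qed.

End flat.

(** * Smoothed step and ramp *)

Section smooth_step.
Context {R : realType}.
Implicit Types (x : R).
Local Notation e1 := (fun _ : unit => (1 : R)).

Lemma smooth_flat m : smooth (@flat R m).
Proof.
move=> k; elim: k m => [|k IH] m; split; try by
  move=> x; apply: differentiable_continuous; apply/derivable1_diffP;
  have [] := is_derive_flat m x.
  by [].
move=> _; split; first by move=> x; have [] := is_derive_flat m x.
have C2 := Ck_alongD (IH m.+2) (Ck_alongM (Ck_along_cst e1 k (- m%:R)) (IH m.+1)).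
by apply: eq_Ck_along C2 => x; have [_ ->] := is_derive_flat m x; rewrite mulNr.
Qed.

Definition step x : R := flat 0 x / (flat 0 x + flat 0 (1 - x)).

Lemma step_den_gt0 x : 0 < flat 0 x + flat 0 (1 - x).
Proof.
have flat_gt0 y : 0 < y -> 0 < flat 0 y.
  by move=> y0; rewrite /flat y0 mul1r expR_gt0.
have [x0|x0] := ltrP 0 x.
  by rewrite ltr_pwDl ?flat_ge0// flat_gt0.
by rewrite ltr_wpDl ?flat_ge0// flat_gt0// subr_gt0; apply: le_lt_trans x0 _.
Qed.

Lemma step0 x : x <= 0 -> step x = 0.
Proof. by move=> x0; rewrite /step {1}/flat ltNge x0 mul0r. Qed.

Lemma step1 x : 1 <= x -> step x = 1.
Proof.
move=> x1; rewrite /step (_ : flat 0 (1 - x) = 0).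
  rewrite addr0 divff// gt_eqF//; have := step_den_gt0 x.
  by rewrite (_ : flat 0 (1 - x) = 0) ?addr0// /flat ltNge subr_le0 x1.
by rewrite /flat ltNge subr_le0 x1.
Qed.

Lemma step_itv x : 0 <= step x <= 1.
Proof.
rewrite /step divr_ge0 ?flat_ge0 ?(ltW (step_den_gt0 x))//=.
by rewrite ler_pdivrMr ?step_den_gt0// mul1r lerDl flat_ge0.
Qed.

Lemma smooth_step : smooth step.
Proof.
move=> k; apply: Ck_alongM; first exact: smooth_flat.
apply: Ck_alongV => [x|]; first by rewrite gt_eqF// step_den_gt0.
apply: Ck_alongD; first exact: smooth_flat.
apply: (@Ck_along_affine _ _ _ e1 k (flat 0) (fun x => 1 - x) (fun=> -1)).
- by move=> x; apply: cvgB; [exact: cvg_cst|exact: cvg_id].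
- by move=> _ h y; rewrite /GRing.scale /=; ring.
- exact: smooth_flat.
Qed.

Lemma smooth_id : smooth (@id R).
Proof.
case=> [|k]; split; try by move=> x; exact: cvg_id.
  by [].
move=> _; split; first by move=> x; exact: derivable_id.
by apply: eq_Ck_along (Ck_along_cst e1 k 1) => x; rewrite derive_id.
Qed.

(** A smooth function that is 0 for x <= 0 and exactly x for x >= 1: after
    rescaling, its derivative approximates a jump, while differences of its
    translates are eventually constant. *)
Definition ramp x : R := x * step x.

Lemma smooth_ramp : smooth ramp.
Proof. by move=> k; apply: Ck_alongM; [exact: smooth_id|exact: smooth_step]. Qed.

Lemma ramp0 x : x <= 0 -> ramp x = 0.
Proof. by move=> x0; rewrite /ramp step0// mulr0. Qed.

Lemma ramp1 x : 1 <= x -> ramp x = x.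
Proof. by move=> x1; rewrite /ramp step1// mulr1. Qed.

Lemma smooth_derivable f x : smooth f -> derivable f x (1 : R).
Proof. by move=> /(_ 1%N) [_ /(_ tt) []]. Qed.

Definition dramp x : R := 'D_1 ramp x.

Lemma drampE x : dramp x = x * 'D_1 step x + step x.
Proof.
rewrite /dramp /ramp.
rewrite (@deriveM _ _ id step x 1) ?derive_id.
- by rewrite /GRing.scale /= mulr1.
- exact: derivable_id.
- exact/smooth_derivable/smooth_step.
Qed.

(** At x = 0 the value comes from [drampE]. *)
Lemma dramp0 x : x <= 0 -> dramp x = 0.
Proof.
rewrite le_eqVlt => /predU1P[->|x0]; first by rewrite drampE mul0r step0// addr0.
rewrite /dramp -(derive_cst (0 : R) x (1 : R)); apply: near_eq_derive.
by near=> y; rewrite ramp0//; apply: ltW; near: y; exact: lt_nbhsl.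
Unshelve. all: by end_near. Qed.

Lemma dramp1 x : 1 < x -> dramp x = 1.
Proof.
move=> x1; rewrite /dramp -[RHS](derive_id x (1 : R)); apply: near_eq_derive.
by near=> y; rewrite ramp1//; apply: ltW; near: y; exact: lt_nbhsr.
Unshelve. all: by end_near. Qed.

Lemma dramp_continuous : continuous dramp.
Proof. by have [_ /(_ tt) [_ []]] := smooth_ramp 1. Qed.

Lemma dramp_bounded : exists M, forall x, `|dramp x| <= M.
Proof.
have [c _ hc] : exists2 c, c \in `[0, 1]%R & forall t, t \in `[0, 1]%R ->
    `|dramp t| <= `|dramp c|.
  apply: (@EVT_max _ (fun x => `|dramp x|) 0 1) => //.
  apply: continuous_subspaceT => x.
  exact: (continuous_comp (@dramp_continuous x) (@norm_continuous _ _ _)).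
exists (Num.max 1 `|dramp c|) => x; rewrite le_max.
have [x0|x0] := leP x 0; first by rewrite dramp0// normr0 ler01.
have [x1|x1] := ltP 1 x; first by rewrite dramp1// normr1 lexx.
by rewrite hc ?orbT// in_itv /= (ltW x0) x1.
Qed.

Definition scale_seq (N n : nat) : R := (N + n).+1%:R.

Lemma scale_seq_gt0 N n : 0 < scale_seq N n.
Proof. by rewrite ltr0n. Qed.

Lemma near_scale_seq N (t : R) : 0 < t -> \forall n \near \oo, 1 < scale_seq N n * t.
Proof.
move=> t0; exists (Num.truncn t^-1).+1 => // n /= hn.
rewrite -ltr_pdivrMr// mul1r; apply: lt_le_trans (truncnS_gt _) _.
by rewrite /scale_seq ler_nat (leq_trans hn)// (leq_trans _ (leqnSn _))// leq_addl.
Qed.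

Lemma cvg_scaled_jump (s : R -> R) N (y a : R) :
  (forall x, x <= 0 -> s x = 0) -> (forall x, 1 < x -> s x = 1) ->
  s (scale_seq N n * (y - a)) @[n --> \oo] --> ((a < y)%R%:R : R).
Proof.
move=> s0 s1; apply: cvg_near_cst; have [ay|ya] := ltrP a y.
  have ya : 0 < y - a by rewrite subr_gt0.
  by have := near_scale_seq N ya; apply: filterS => n h; rewrite s1.
by apply: nearW => n; rewrite s0// mulr_ge0_le0 ?subr_le0// ltW// scale_seq_gt0.
Qed.

Lemma cvg_prod_fin (J : Type) (r : seq J) (P : pred J) (u : J -> nat -> R) (l : J -> R) :
  (forall j, u j n @[n --> \oo] --> l j) ->
  \prod_(j <- r | P j) u j n @[n --> \oo] --> \prod_(j <- r | P j) l j.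
Proof. by move=> ul; apply: cvg_big => //; exact: mul_continuous. Qed.

End smooth_step.

(** * Tensor products and means over boxes *)

Section tensor.
Context {R : realType} {d : nat}.
Local Notation E := 'rV[R]_d.+1.
Variable Omega : set E.
Implicit Types (g : 'I_d.+1 -> R -> R) (x : E).

Definition tensor g x : R := \prod_j g j (x ord0 j).

Lemma Ck_along_Ck k (phi : E -> R) :
  Ck_along (fun i : 'I_d.+1 => delta_mx ord0 i : E) k phi -> Ck k phi.
Proof.
elim: k phi => [|k IH] phi /= [cphi dphi].
  by split.
split; first exact: cphi.
move=> i.
by have [d1 d2] := dphi i; split => //; exact: IH.
Qed.

Lemma coord_line i j (h : R) x :
  (h *: delta_mx ord0 i + x) ord0 j = h * (j == i)%:R + x ord0 j.
Proof. by rewrite !mxE eqxx. Qed.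

Lemma Ck_tensor g k : (forall j, smooth (g j)) -> Ck k (tensor g).
Proof.
move=> sg; apply: Ck_along_Ck; apply: Ck_along_prod => j.
apply: (@Ck_along_affine _ _ _ _ k (g j) (fun x : E => x ord0 j)
  (fun i => (j == i)%:R)) => [|i h y|].
- exact: coord_continuous.
- exact: coord_line.
- exact: sg.
Qed.

Lemma tensor_test g (l h : 'I_d.+1 -> R) : (forall j, smooth (g j)) ->
  (forall j s, s < l j -> g j s = 0) -> (forall j s, h j < s -> g j s = 0) ->
  [set x : E | forall j, l j <= x ord0 j <= h j] `<=` Omega ->
  test_function Omega (tensor g).
Proof.
move=> sg gl gh BO; set B := [set x | _] in BO.
have cB : compact B.
  have := @rV_compact R d.+1 (fun j => `[l j, h j]%classic).
  rewrite (_ : [set v | _] = B); last first.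
    by apply/seteqP; split => x /= hx j; have := hx j; rewrite /= in_itv.
  by apply => j; exact: segment_compact.
have clB : closed B by apply: compact_closed => //; exact: norm_hausdorff.
have sB : closure [set x | tensor g x != 0] `<=` B.
  rewrite (closure_id B).1//; apply: closureS => x /= gx j.
  have gj : g j (x ord0 j) != 0.
    by apply: contra gx => /eqP gj; rewrite /tensor (bigD1 j)//= gj mul0r.
  rewrite !leNgt; apply/andP; split; apply: contra gj => lt; apply/eqP.
    exact: gl.
  exact: gh.
split.
- by move=> k; exact: Ck_tensor.
- by apply: subclosed_compact sB => //; exact: closed_closure.
- exact: subset_trans sB BO.
Qed.

Lemma derive_line_eq (f g : E -> R) (v x : E) :
  (forall h, f (h *: v + x) = g (h *: v + x)) -> 'D_v f x = 'D_v g x.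
Proof.
move=> fg; have qE : (fun h : R => h^-1 *: ((f \o shift x) (h *: v) - f x)) =
    (fun h => h^-1 *: ((g \o shift x) (h *: v) - g x)).
  apply/funext => h; rewrite /= fg.
  by have := fg 0; rewrite scale0r add0r => ->.
by rewrite /derive qE.
Qed.

Lemma partial_tensor g i x : (forall j, smooth (g j)) ->
  partial i (tensor g) x =
  'D_1 (g i) (x ord0 i) * \prod_(j | j != i) g j (x ord0 j).
Proof.
move=> sg; set q := \prod_(j | _) _.
pose G (s : R) : R := g i s * cst q s.
have dG s : is_derive s (1 : R) G ('D_1 (g i) s * q).
  have dgi := derivableP (@smooth_derivable _ _ s (sg i)).
  apply: is_derive_eq (is_deriveM dgi (is_derive_cst q s 1)) _.
  by rewrite /GRing.scale /= mulr0 add0r mulrC.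
have LE (h : R) (y : E) : (h *: delta_mx ord0 i + y) ord0 i = h * 1 + y ord0 i.
  by rewrite coord_line eqxx.
have [dG1 dG2] := dG (x ord0 i).
have [_ dGL] := @derive_affine _ _ G (fun y : E => y ord0 i) (delta_mx ord0 i) x 1 LE dG1.
rewrite -dG2 -[RHS]mul1r -dGL; apply: derive_line_eq => h.
rewrite /tensor (bigD1 i)//= /G; congr (_ * _); apply: eq_bigr => j ji.
by rewrite coord_line (negbTE ji) mulr0 add0r.
Qed.

End tensor.

Section box_average.
Context {R : realType} {d : nat}.
Local Notation E := 'rV[R]_d.+1.
Local Notation mu := (@lebesgue_rV R d.+1).
Variable Omega : set E.
Hypothesis oO : open Omega.
Let mO : measurable Omega := open_measurable_rV oO.
Variable w : E -> R.
Hypothesis iw : mu.-integrable Omega (EFin \o w).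
Hypothesis hw : forall i phi, test_function Omega phi ->
  \int[mu]_(x in Omega) (w x * partial i phi x) = 0.
(* Boxes are taken in the cube of radius r' and center c; the smooth
   approximations at scale K extend them by 1 / K, for which r - r' is the room. *)
Variables (c : E) (r r' : R).
Hypothesis r'r : r' < r.
Hypothesis cube_sub :
  [set x : E | forall j, c ord0 j - r' <= x ord0 j <= c ord0 j + r] `<=` Omega.

Definition ramp_at (K t s : R) : R := K^-1 * ramp (K * (s - t)).

Lemma smooth_scaled f (K t : R) : smooth f -> smooth (fun s => f (K * (s - t))).
Proof.
move=> sf k; apply: (@Ck_along_affine _ _ _ _ k f (fun s => K * (s - t)) (fun=> K)).
- by move=> s; apply: cvgM; [exact: cvg_cst|apply: cvgB; [exact: cvg_id|exact: cvg_cst]].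
- by move=> _ h y; rewrite /GRing.scale /=; ring.
- exact: sf.
Qed.

Lemma smooth_ramp_at K t : smooth (ramp_at K t).
Proof.
move=> k; apply: Ck_alongM; first exact: Ck_along_cst.
exact: (smooth_scaled (f := ramp) K t smooth_ramp).
Qed.

Lemma derive_ramp_at K t s : K != 0 -> 'D_1 (ramp_at K t) s = dramp (K * (s - t)).
Proof.
move=> K0; rewrite /ramp_at.
have LE (h y : R) : K * (h *: (1 : R) + y - t) = h * K + K * (y - t).
  by rewrite /GRing.scale /=; ring.
have dr := @smooth_derivable _ _ (K * (s - t)) (@smooth_ramp R).
have H := @derive_affine _ _ ramp (fun s : R => K * (s - t)) 1 s K LE dr.
have [_] := is_deriveM (is_derive_cst K^-1 s (1 : R)) H.
rewrite /GRing.scale /= mulr0 addr0 => ->.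
by rewrite mulrA mulVf// mul1r.
Qed.

Definition admissible (a b : E) :=
  forall j, [/\ c ord0 j - r' <= a ord0 j, a ord0 j < b ord0 j & b ord0 j <= c ord0 j + r'].

Lemma admissible_sub a b : admissible a b -> box a b `<=` Omega.
Proof.
move=> ab x xab; apply: cube_sub => j; have [h1 _ h2] := ab j.
have /andP[x1 x2] := xab j; apply/andP; split.
  exact: le_trans h1 (ltW x1).
by apply: le_trans x2 (le_trans h2 _); rewrite lerD2l ltW.
Qed.

Definition side (K a b s : R) : R := step (K * (s - a)) - step (K * (s - b)).

(** A smooth approximation of the primitive of 1_(]a, b]) / (b - a) that is 0 on
    the left of the interval and 1 on its right. *)
Definition slope (K a b s : R) : R := (ramp_at K a s - ramp_at K b s) / (b - a).

Lemma indic_boxE (a b x : E) : (forall j, a ord0 j < b ord0 j) ->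
  \1_(box a b) x = \prod_j ((a ord0 j < x ord0 j)%R%:R - (b ord0 j < x ord0 j)%R%:R) :> R.
Proof.
move=> ab; rewrite indicE; have [xab|xab] := boolP (x \in box a b).
  rewrite big1// => j _; move: xab; rewrite inE => /(_ j) /andP[-> xb].
  by rewrite ltNge xb subr0.
apply/esym/eqP; rewrite prodf_seq_eq0; apply/hasP.
move: xab; rewrite notin_setE => /existsNP[j /negP hj]; exists j.
  exact: mem_index_enum.
rewrite /=; have := ab j; move: hj; rewrite negb_and -leNgt -ltNge => /orP[xa abj|bx abj].
  by rewrite !ltNge xa (le_trans xa (ltW abj)) subrr.
by rewrite bx (lt_trans abj bx) subrr.
Qed.

Lemma smooth_slope K a b : smooth (slope K a b).
Proof.
move=> k; apply: Ck_alongM; last exact: Ck_along_cst.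
have Cb := Ck_alongM (Ck_along_cst (fun _ : unit => (1 : R)) k (-1)) (smooth_ramp_at K b k).
by apply: eq_Ck_along (Ck_alongD (smooth_ramp_at K a k) Cb) => x; rewrite mulN1r.
Qed.

Lemma smooth_side K a b : smooth (side K a b).
Proof.
move=> k; have Ca := smooth_scaled K a (@smooth_step R) k.
have Cb := Ck_alongM (Ck_along_cst (fun _ : unit => (1 : R)) k (-1))
  (smooth_scaled K b (@smooth_step R) k).
by apply: eq_Ck_along (Ck_alongD Ca Cb) => x; rewrite mulN1r.
Qed.

Lemma derive_slope K a b s : K != 0 ->
  'D_1 (slope K a b) s = (dramp (K * (s - a)) - dramp (K * (s - b))) / (b - a).
Proof.
move=> K0; rewrite -!derive_ramp_at//.
have da := derivableP (@smooth_derivable _ _ s (smooth_ramp_at K a)).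
have db := derivableP (@smooth_derivable _ _ s (smooth_ramp_at K b)).
have [_] := is_deriveM (is_deriveB da db) (is_derive_cst (b - a)^-1 s (1 : R)).
by rewrite /GRing.scale /= mulr0 add0r [RHS]mulrC.
Qed.

Lemma side_left K a b s : 0 < K -> s <= a -> s <= b -> side K a b s = 0.
Proof.
by move=> K0 sa sb; rewrite /side !step0 ?subrr// mulr_ge0_le0 ?subr_le0// ltW.
Qed.

Lemma side_right K a b s : 1 <= K * (s - a) -> 1 <= K * (s - b) -> side K a b s = 0.
Proof. by move=> sa sb; rewrite /side !step1 ?subrr. Qed.

Lemma side_le1 K a b s : `|side K a b s| <= 1.
Proof.
rewrite /side; have /andP[? ?] := step_itv (K * (s - a)).
have /andP[? ?] := step_itv (K * (s - b)).
by rewrite ler_norml; apply/andP; split; lra.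
Qed.

Lemma slope_left K a b s : 0 < K -> s <= a -> s <= b -> slope K a b s = 0.
Proof.
move=> K0 sa sb; rewrite /slope /ramp_at !ramp0 ?mulr0 ?subrr ?mul0r//;
by rewrite mulr_ge0_le0 ?subr_le0// ltW.
Qed.

Lemma slope_right K a b s : 0 < K -> a < b ->
  1 <= K * (s - a) -> 1 <= K * (s - b) -> slope K a b s = 1.
Proof.
move=> K0 ab sa sb; rewrite /slope /ramp_at !ramp1// !mulKf ?gt_eqF//.
by rewrite opprB addrC subrKA divff// subr_eq0 gt_eqF.
Qed.

Lemma integral_indic_box (a b : E) (k : R) : box a b `<=` Omega ->
  \int[mu]_(x in Omega) (w x * (k * \1_(box a b) x)) =
  k * \int[mu]_(x in box a b) w x.
Proof.
move=> BO; have mB := measurable_box a b.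
rewrite -RintegralZl//; last exact: integrableS iw.
rewrite -[in RHS](setIidr BO) Rintegral_mkcondr; apply: eq_Rintegral => x _.
by rewrite /patch indicE; case: ifPn; rewrite ?mulr1 ?mulr0// mulrC.
Qed.

(** The difference of the slopes of the two sides, multiplied by the smoothed
    indicators of the common sides, is a test function.  As the scale goes to
    infinity its derivative in the direction i converges boundedly to the
    difference of the normalized indicators of the two boxes. *)
Lemma box_average_eq i (a b a' b' : E) : admissible a b -> admissible a' b' ->
  (forall j, j != i -> a ord0 j = a' ord0 j /\ b ord0 j = b' ord0 j) ->
  (b ord0 i - a ord0 i)^-1 * \int[mu]_(x in box a b) w x =
  (b' ord0 i - a' ord0 i)^-1 * \int[mu]_(x in box a' b') w x.
Proof.
move=> ab ab' aa'.
(* From the scale N + 1 on, the supports stay within the cube contained in Omega. *)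
have [N hN] : exists N : nat, 1 <= N.+1%:R * (r - r').
  exists (Num.truncn (r - r')^-1); rewrite -ler_pdivrMr ?subr_gt0// mul1r.
  exact/ltW/truncnS_gt.
pose K n : R := scale_seq N n.
have K0 n : 0 < K n by exact: scale_seq_gt0.
(* Beyond c + r, all smoothed steps and ramps are in their final regime. *)
have Kr n (j : 'I_d.+1) (t s : R) : t <= c ord0 j + r' -> c ord0 j + r < s ->
    1 <= K n * (s - t).
  move=> h1 h2; apply: le_trans hN _; apply: ler_pM => //; first by rewrite subr_ge0 ltW.
    by rewrite /K /scale_seq ler_nat ltnS leq_addr.
  by lra.
pose g n (j : 'I_d.+1) : R -> R := if j == i then
    fun s => slope (K n) (a ord0 i) (b ord0 i) s - slope (K n) (a' ord0 i) (b' ord0 i) s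
  else side (K n) (a ord0 j) (b ord0 j).
have sg n j : smooth (g n j).
  rewrite /g; case: ifP => _; last exact: smooth_side.
  move=> k; have C' := Ck_alongM (Ck_along_cst (fun _ : unit => (1 : R)) k (-1))
    (smooth_slope (K n) (a' ord0 i) (b' ord0 i) k).
  apply: eq_Ck_along (Ck_alongD (smooth_slope (K n) (a ord0 i) (b ord0 i) k) C') => x.
  by rewrite mulN1r.
have tg n : test_function Omega (tensor (g n)).
  apply: (@tensor_test _ _ _ _ (fun j => c ord0 j - r') (fun j => c ord0 j + r)) => //.
    move=> j s sl; have [h1 h2 h3] := ab j; have [h1' h2' h3'] := ab' j.
    rewrite /g; case: ifPn => [/eqP ji|_].
      by subst j; rewrite !slope_left ?subrr//; lra.
    by rewrite side_left//; lra.
  move=> j s sl; have [h1 h2 h3] := ab j; have [h1' h2' h3'] := ab' j.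
  rewrite /g; case: ifPn => [/eqP ji|_].
    by subst j; rewrite !slope_right ?subrr//; apply: (Kr n i) => //; lra.
  by rewrite side_right//; apply: (Kr n j) => //; lra.
pose q n (x : E) : R := \prod_(j | j != i) side (K n) (a ord0 j) (b ord0 j) (x ord0 j).
pose D n (t t' s : R) : R := (dramp (K n * (s - t)) - dramp (K n * (s - t'))) / (t' - t).
have FE n x : partial i (tensor (g n)) x =
    (D n (a ord0 i) (b ord0 i) (x ord0 i) - D n (a' ord0 i) (b' ord0 i) (x ord0 i)) * q n x.
  rewrite partial_tensor//; congr (_ * _); last first.
    by apply: eq_bigr => j ji; rewrite /g (negbTE ji).
  have Kn0 : K n != 0 by rewrite gt_eqF.
  rewrite /g eqxx.
  transitivity ('D_1 (slope (K n) (a ord0 i) (b ord0 i)) (x ord0 i) -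
      'D_1 (slope (K n) (a' ord0 i) (b' ord0 i)) (x ord0 i)).
    by apply: deriveB; exact/smooth_derivable/smooth_slope.
  by rewrite !(derive_slope _ _ _ Kn0).
pose jump (t t' s : R) : R := (t < s)%R%:R - (t' < s)%R%:R.
pose Q (x : E) : R := \prod_(j | j != i) jump (a ord0 j) (b ord0 j) (x ord0 j).
have box1 (x : E) : \1_(box a b) x = jump (a ord0 i) (b ord0 i) (x ord0 i) * Q x.
  rewrite indic_boxE; last by move=> j; have [] := ab j.
  by rewrite (bigD1 i erefl); congr (_ * _).
have box2 (x : E) : \1_(box a' b') x = jump (a' ord0 i) (b' ord0 i) (x ord0 i) * Q x.
  rewrite indic_boxE; last by move=> j; have [] := ab' j.
  by rewrite (bigD1 i erefl); congr (_ * _); apply: eq_bigr => j /aa'[-> ->].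
pose F (x : E) : R := (b ord0 i - a ord0 i)^-1 * \1_(box a b) x
  - (b' ord0 i - a' ord0 i)^-1 * \1_(box a' b') x.
have Dcvg t t' s : D n t t' s @[n --> \oo] --> jump t t' s / (t' - t).
  apply: cvgM; last exact: cvg_cst.
  by apply: cvgB; apply: cvg_scaled_jump; [exact: dramp0|exact: dramp1|exact: dramp0|exact: dramp1].
have Fcvg x : partial i (tensor (g n)) x @[n --> \oo] --> F x.
  rewrite (_ : F x = (jump (a ord0 i) (b ord0 i) (x ord0 i) / (b ord0 i - a ord0 i)
     - jump (a' ord0 i) (b' ord0 i) (x ord0 i) / (b' ord0 i - a' ord0 i)) * Q x); last first.
    by rewrite /F box1 box2; ring.
  under eq_fun do rewrite FE.
  apply: cvgM; first by apply: cvgB; exact: Dcvg.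
  apply: cvg_prod_fin => j.
  by apply: cvgB; apply: cvg_scaled_jump;
    [exact: step0|move=> y /ltW; exact: step1|exact: step0|move=> y /ltW; exact: step1].
have [M hM] := @dramp_bounded R.
pose M0 := 2 * M / (b ord0 i - a ord0 i) + 2 * M / (b' ord0 i - a' ord0 i).
have Dle n t t' s : t < t' -> `|D n t t' s| <= 2 * M / (t' - t).
  move=> tt'; rewrite /D normrM (ger0_norm (x := (t' - t)^-1)); last first.
    by rewrite invr_ge0 subr_ge0 ltW.
  rewrite ler_wpM2r ?invr_ge0 ?subr_ge0 ?(ltW tt')//.
  by apply: le_trans (ler_normB _ _) _; rewrite mulr_natl mulr2n lerD.
have Fle n x : `|partial i (tensor (g n)) x| <= M0.
  rewrite FE normrM -[M0]mulr1; apply: ler_pM => //.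
    apply: le_trans (ler_normB _ _) _.
    by apply: lerD; apply: Dle; [have [] := ab i|have [] := ab' i].
  rewrite /q normr_prod; apply: prodr_ile1 => j _.
  by rewrite normr_ge0 side_le1.
have /measurable_EFinP mw := measurable_int _ iw.
have mF : measurable_fun Omega F.
  by apply: measurable_funB; apply: measurable_funM => //;
    apply: measurable_funTS; apply: measurable_indic; exact: measurable_box.
have iM : mu.-integrable Omega (EFin \o (fun x => M0 * `|w x|)).
  rewrite (_ : _ \o _ = fun x => (M0%:E * (EFin \o (fun x => `|w x|%R)) x)%E)//.
  by apply: integrableZl => //; exact: integrable_norm.
have mFn n : measurable_fun Omega (partial i (tensor (g n))).
  by apply: measurable_funTS; exact: (test_measurable (test_partial i (tg n))).
have [] := @dominated_convergence _ _ _ mu Omega mO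
   (fun n => EFin \o (fun x => w x * partial i (tensor (g n)) x))
   (EFin \o (fun x => w x * F x)) (EFin \o (fun x => M0 * `|w x|)).
- by move=> n; apply/measurable_EFinP; exact: measurable_funM mw (mFn n).
- by apply/measurable_EFinP; exact: measurable_funM mw mF.
- apply: nearW => x _; apply: cvg_EFin; first exact: nearW.
  by apply: cvgM; [exact: cvg_cst|exact: Fcvg].
- exact: iM.
- apply: nearW => x n _; rewrite /= lee_fin normrM mulrC.
  by rewrite ler_wpM2r// Fle.
move=> _ _; rewrite (_ : (fun n => _) = cst 0%E); last first.
  apply/funext => n; rewrite -[LHS]fineK; first by congr EFin; exact: hw.
  have int_n : mu.-integrable Omega (EFin \o (fun x => w x * partial i (tensor (g n)) x)).
    apply: (le_integrable mO _ _ iM); last first.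
      move=> x _; rewrite /= lee_fin normrM [leRHS]ger0_norm.
        by rewrite mulrC ler_wpM2r// Fle.
      by rewrite mulr_ge0// (le_trans _ (Fle 0%N 0)).
    by apply/measurable_EFinP; exact: measurable_funM mw (mFn n).
  exact: integrable_fin_num int_n.
move=> /cvg_lim => /(_ (@ereal_hausdorff R)).
rewrite lim_cst; last exact: ereal_hausdorff.
move=> F0.
have : \int[mu]_(x in Omega) (w x * F x) = 0 by rewrite /Rintegral -F0.
have ib (k : R) (l h : E) : mu.-integrable Omega (EFin \o (fun x => w x * (k * \1_(box l h) x))).
  apply: (le_integrable mO _ _ (_ : mu.-integrable Omega (EFin \o (fun x => k * w x)))).
  - apply/measurable_EFinP; apply: measurable_funM => //; apply: measurable_funM => //.
    by apply: measurable_funTS; apply: measurable_indic; exact: measurable_box.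
  - move=> x _; rewrite /= lee_fin mulrA mulrC (mulrC k) normrM ler_piMl//.
    by rewrite indicE; case: (_ \in _); rewrite ?normr1 ?normr0.
  - rewrite (_ : _ \o _ = fun x => (k%:E * (EFin \o w) x)%E)//.
    exact: integrableZl.
rewrite /F (_ : (fun x => _) = (fun x =>
    w x * ((b ord0 i - a ord0 i)^-1 * \1_(box a b) x) -
    w x * ((b' ord0 i - a' ord0 i)^-1 * \1_(box a' b') x))); last first.
  by apply/funext => x; rewrite mulrBr.
rewrite RintegralB// !integral_indic_box; [|exact: admissible_sub..].
by move/eqP; rewrite subr_eq0 => /eqP.
Qed.

End box_average.

(** * Functions with zero weak gradient *)

Section local_constancy.
Context {R : realType} {d : nat}.
Local Notation E := 'rV[R]_d.+1.
Local Notation mu := (@lebesgue_rV R d.+1).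
Variable Omega : set E.
Hypothesis oO : open Omega.
Let mO : measurable Omega := open_measurable_rV oO.
Variable w : E -> R.
Hypothesis iw : mu.-integrable Omega (EFin \o w).
Hypothesis hw : forall i phi, test_function Omega phi ->
  \int[mu]_(x in Omega) (w x * partial i phi x) = 0.
Variables (c : E) (r r' : R).
Hypothesis r'0 : 0 < r'.
Hypothesis r'r : r' < r.
Hypothesis cube_sub :
  [set x : E | forall j, c ord0 j - r' <= x ord0 j <= c ord0 j + r] `<=` Omega.

Let a0 : E := c - const_mx r'.
Let b0 : E := c + const_mx r'.

Let ab0 : admissible c r' a0 b0.
Proof. by move=> j; rewrite /a0 /b0 !mxE; have := r'0; split; lra. Qed.

(** A box is reached from the reference cube by replacing one side at a time. *)
Lemma box_average_const : exists k, forall a b, admissible c r' a b ->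
  \int[mu]_(x in box a b) w x = k * \prod_j (b ord0 j - a ord0 j).
Proof.
pose avg (a b : E) := (\prod_j (b ord0 j - a ord0 j))^-1 * \int[mu]_(x in box a b) w x.
exists (avg a0 b0) => a b ab.
(* The endpoints after replacement of the first m sides. *)
pose hy (x0 x : E) (m : nat) : E := \row_j (if (j < m)%N then x ord0 j else x0 ord0 j).
have hadm m : admissible c r' (hy a0 a m) (hy b0 b m).
  move=> j; rewrite [hy a0 a m _ _]mxE [hy b0 b m _ _]mxE.
  by case: ifP => _; [exact: ab|exact: ab0].
have len_neq0 x y j : admissible c r' x y -> y ord0 j - x ord0 j != 0.
  by move=> /(_ j)[_ xy _]; rewrite subr_eq0 gt_eqF.
have avgE m : (m <= d.+1)%N -> avg (hy a0 a m) (hy b0 b m) = avg a0 b0.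
  elim: m => [_|m IH md].
    by congr avg; apply/rowP => j; rewrite !mxE.
  rewrite -IH; last exact: ltnW.
  pose i := Ordinal md.
  have same j : j != i -> hy a0 a m ord0 j = hy a0 a m.+1 ord0 j /\
      hy b0 b m ord0 j = hy b0 b m.+1 ord0 j.
    move=> ji; rewrite !mxE ltnS [(j <= m)%N]leq_eqVlt.
    by rewrite (_ : (j == m :> nat) = false)//; apply/negbTE; rewrite -val_eqE in ji.
  have E1 := box_average_eq oO iw hw r'r cube_sub (hadm m) (hadm m.+1) same.
  have E2 : \prod_(j | j != i) (hy b0 b m ord0 j - hy a0 a m ord0 j) =
     \prod_(j | j != i) (hy b0 b m.+1 ord0 j - hy a0 a m.+1 ord0 j).
    by apply: eq_bigr => j /same[-> ->].
  rewrite /avg !(bigD1 i erefl) /= -E2 !invfM ![_ * (\prod_(_ | _) _)^-1]mulrC.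
  by rewrite -!mulrA E1.
have [hya hyb] : hy a0 a d.+1 = a /\ hy b0 b d.+1 = b.
  by split; apply/rowP => j; rewrite mxE ltn_ord.
have := avgE d.+1 (leqnn _); rewrite hya hyb => <-.
rewrite /avg mulrAC mulVf ?mul1r// prodf_seq_neq0; apply/allP => j _ /=.
exact: len_neq0.
Qed.

Lemma admissible_integrable (a b : E) : admissible c r' a b ->
  mu.-integrable (box a b) (EFin \o w).
Proof.
move=> ab; apply: integrableS iw => //; first exact: measurable_box.
exact: (admissible_sub r'r cube_sub ab).
Qed.

(** The sets A such that w - k has zero integral over the intersection of A with
    the cube Q form a Dynkin system, which contains the boxes; so w - k has zero
    integral on all measurable subsets of Q. *)
Lemma local_constancy : exists k, ae_on (ball c r') (fun x => w x = k).
Proof.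
have [k hk] := box_average_const; exists k.
pose Q := box a0 b0.
have mQ : measurable Q by exact: measurable_box.
have QO : Q `<=` Omega by exact: (admissible_sub r'r cube_sub ab0).
pose w' (x : E) : R := w x - k.
have iwk (A : set E) : measurable A -> A `<=` Q -> mu.-integrable A (EFin \o w').
  move=> mA AQ.
  have iwA : mu.-integrable A (EFin \o w).
    by apply: integrableS iw => //; exact: subset_trans AQ QO.
  have ikA : mu.-integrable A (EFin \o cst k).
    apply: (@integrableS _ _ _ _ Q) => //.
    apply: measurable_bounded_integrable => //; first exact: lebesgue_box_lty.
    by exists `|k|; split => // M kM x _; exact: ltW.
  exact: (integrableB mA iwA ikA).
pose D : set (set E) := [set A | measurable A /\ (\int[mu]_(x in A `&` Q) (EFin \o w') x = 0)%E].
have Dbox : boxes `<=` D.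
  move=> _ [a _ [b _ <-]]; split; first exact: measurable_box.
  rewrite /Q boxI; set a1 := \row_i _; set b1 := \row_i _.
  have [[i ba]|h] := pselect (exists i, b1 ord0 i <= a1 ord0 i).
    by rewrite (box0 ba) integral_set0.
  have ab1 i : a1 ord0 i < b1 ord0 i.
    by rewrite ltNge; apply/negP => ba; apply: h; exists i.
  have adm : admissible c r' a1 b1.
    move=> j; split => //.
      by rewrite /a1 /a0 !mxE le_max lexx orbT.
    by rewrite /b1 /b0 !mxE ge_min lexx orbT.
  have mB := measurable_box a1 b1.
  have BQ : box a1 b1 `<=` Q by rewrite /Q /a1 /b1 -boxI; exact: subIsetr.
  rewrite -(fineK (integrable_fin_num mB (iwk _ mB BQ))); congr EFin.
  transitivity (\int[mu]_(x in box a1 b1) (w x - cst k x)) => //.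
  rewrite RintegralB//; last 2 first.
    exact: admissible_integrable.
    apply: measurable_bounded_integrable => //; first exact: lebesgue_box_lty.
    by exists `|k|; split => // M kM x _; exact: ltW.
  rewrite hk// Rintegral_cst// [X in fine X](lebesgue_box (fun i => ltW (ab1 i))).
  by rewrite subrr.
have QE : (\int[mu]_(x in Q) (EFin \o w') x = 0)%E.
  have [_ ] : D Q by apply: Dbox; exists a0 => //; exists b0.
  by rewrite setIid.
have Ddyn : dynkin D.
  split.
  - by split => //; rewrite setTI.
  - move=> A [mA A0]; split; first exact: measurableC.
    have := QE; have -> : Q = (A `&` Q) `|` (~` A `&` Q).
      by rewrite -setIUl setUv setTI.
    rewrite integral_setU//.
    + by rewrite {1}(_ : _ `|` _ = Q) ?A0 ?add0e// -setIUl setUv setTI.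
    + exact: measurableI.
    + by apply: measurableI => //; exact: measurableC.
    + apply: measurable_int; rewrite -setIUl setUv setTI; exact: iwk.
    + by apply/disj_setPS => x [[? _] []].
  - move=> F tF DF; split.
      by apply: bigcupT_measurable => n; have [] := DF n.
    rewrite setI_bigcupl integral_bigcup//.
    + by rewrite eseries0// => n _ _; have [] := DF n.
    + exact: trivIset_setIr.
    + by move=> n; apply: measurableI => //; have [] := DF n.
    + apply: iwk; last by rewrite -setI_bigcupl; exact: subIsetr.
      by apply: bigcupT_measurable => n; apply: measurableI => //; have [] := DF n.
have DA (A : set E) : measurable A -> D A.
  rewrite measurable_boxesE -(setI_closed_g_dynkin_g_sigma_algebra setI_closed_boxes).
  by apply: smallest_sub.
have : ae_eq mu Q (EFin \o w') (cst 0%E).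
  apply: integral_ae_eq => //; first exact: iwk.
  by move=> A AQ mA; rewrite integral0; have [_] := DA A mA; rewrite setIidl.
rewrite /ae_on; apply: filterS => x h bx.
have : Q x.
  move=> j; move: bx; rewrite ball_rVE => /(_ j); rewrite ltr_distl !mxE => /andP[x1 x2].
  by apply/andP; split; lra.
by move=> /h [] /eqP; rewrite subr_eq0 => /eqP.
Qed.

End local_constancy.

Section global_constancy.
Context {R : realType} {d : nat}.
Local Notation E := 'rV[R]_d.+1.
Local Notation mu := (@lebesgue_rV R d.+1).

Lemma ball_const_unique (w : E -> R) (x : E) (e k k' : R) : 0 < e ->
  ae_on (ball x e) (fun y => w y = k) -> ae_on (ball x e) (fun y => w y = k') ->
  k = k'.
Proof.
move=> e0 wk wk'; apply/eqP/negPn/negP => /eqP kk'.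
pose B := box (x - const_mx (e / 2)) (x + const_mx (e / 2)).
have Bx : B `<=` ball x e.
  move=> y yB; rewrite ball_rVE => j; have := yB j; rewrite !mxE => /andP[y1 y2].
  by rewrite ltr_distl; apply/andP; split; lra.
have mB : measurable B by exact: measurable_box.
have : {ae mu, forall y, ~ B y}.
  move: wk wk'; rewrite /ae_on; apply: filterS2 => y h h' /Bx yB.
  by apply: kk'; rewrite -(h yB) -(h' yB).
move=> [N [mN N0 BN]].
have /eqP : mu B = 0%E.
  apply/eqP; rewrite eq_le measure_ge0 andbT -N0; apply: le_measure; rewrite ?inE//.
  by move=> y yB; apply: BN => /=; exact.
rewrite /B lebesgue_box => [|i]; last by rewrite !mxE; lra.
rewrite eqe gt_eqF// prodr_gt0// => i _; rewrite !mxE; lra.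
Qed.

(** The sets U k of points near which w is a.e. equal to k are open and pairwise
    disjoint, and they cover Omega; connectedness leaves a single k.  Countably
    many rational boxes then gather the local null sets into one. *)
Lemma connected_constancy (Omega : set E) (w : E -> R) :
  open Omega -> connected Omega -> Omega !=set0 ->
  (forall x, Omega x -> exists2 e, 0 < e & exists k, ae_on (ball x e) (fun y => w y = k)) ->
  exists k, ae_on Omega (fun y => w y = k).
Proof.
move=> oO cO [x0 Ox0] loc.
pose U k := [set x | exists2 e, 0 < e & ae_on (ball x e) (fun y => w y = k)].
have oU k : open (U k).
  rewrite openE => x [e e0 xk]; apply/nbhs_ballP; exists (e / 2); first exact: divr_gt0.
  move=> y xy; exists (e / 2); first exact: divr_gt0.
  move: xk; rewrite /ae_on; apply: filterS => z h yz; apply: h.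
  exact: ball_split xy yz.
have Udisj k k' x : U k x -> U k' x -> k = k'.
  move=> [e e0 h] [e' e'0 h'].
  have me : Num.min e e' <= e by rewrite ge_min lexx.
  have me' : Num.min e e' <= e' by rewrite ge_min lexx orbT.
  apply: (@ball_const_unique w x (Num.min e e')); first by rewrite lt_min e0.
    by move: h; rewrite /ae_on; apply: filterS => y h /(le_ball me)/h.
  by move: h'; rewrite /ae_on; apply: filterS => y h' /(le_ball me')/h'.
have [e0 e00 [k0 x0k0]] := loc _ Ox0.
have OU : Omega `&` U k0 = Omega.
  apply: cO.
  - by exists x0; split => //; exists e0.
  - by exists (U k0).
  - exists (~` \bigcup_(k in [set k | k != k0]) U k).
      by apply: open_closedC; apply: bigcup_open.
    apply/seteqP; split => x [Ox Ux]; split => //.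
      by move=> [k /= kk0 Ukx]; move: kk0; rewrite (Udisj _ _ _ Ukx Ux) eqxx.
    have [e e_gt0 [k xk]] := loc _ Ox.
    have Ukx : U k x by exists e.
    have [<-//|kk0] := eqVneq k k0.
    by exfalso; apply: Ux; exists k.
exists k0.
pose good (p : 'rV[rat]_d.+1 * nat) := ae_on (rat_box p) (fun y => w y = k0).
(* Indexing by nat through pickle makes the intersection of the a.e. sets countable. *)
pose P (n : nat) (y : E) : Prop :=
  forall p, pickle p = n -> good p -> rat_box p y -> w y = k0.
have aeP : {ae mu, forall y n, P n y}.
  apply: ae_foralln => n.
  have [[p [pn gp]]|np] := pselect (exists p, pickle p = n /\ good p).
    move: (gp); rewrite /good /ae_on; apply: filterS => y h q qn _.
    by have -> : q = p by apply: (pcan_inj pickleK); rewrite qn pn.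
  by apply: nearW => y q qn gq; exfalso; apply: np; exists q.
move: aeP; rewrite /ae_on; apply: filterS => y h Oy.
have [_ [e e_gt0 ye]] : (Omega `&` U k0) y by rewrite OU.
have [p py pB] := rat_box_basis (ball_open y e) (ballxx y e_gt0).
apply: (h (pickle p) p erefl) => //.
by move: ye; rewrite /good /ae_on; apply: filterS => z h' /pB/h'.
Qed.

Lemma weak_grad0_constancy (Omega : set E) (w : E -> R) :
  open Omega -> bounded_set Omega -> connected Omega -> Omega !=set0 ->
  L2 Omega w ->
  (forall i phi, test_function Omega phi ->
    \int[mu]_(x in Omega) (w x * partial i phi x) = 0) ->
  exists k, ae_on Omega (fun x => w x = k).
Proof.
move=> oO bO cO nO Lw hw; apply: connected_constancy => // c Oc.
have mO := open_measurable_rV oO.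
have iw : mu.-integrable Omega (EFin \o w).
  have := L2_mul_integrable mO Lw (L2_cst oO bO 1).
  by congr (integrable mu Omega (EFin \o _)); apply/funext => x; rewrite /= mulr1.
have /nbhs_ballP[e /= e0 cU] : nbhs c Omega by exact: open_nbhs_nbhs.
exists (e / 4); first by rewrite divr_gt0.
apply: (@local_constancy _ _ Omega oO w iw hw c (e / 2) (e / 4)); [lra|lra|].
move=> x hx; apply: cU; rewrite ball_rVE => j.
by have /andP[x1 x2] := hx j; rewrite ltr_distl; apply/andP; split; lra.
Qed.

End global_constancy.

(** * Minimality of the solution *)

Theorem theorem2p1 (R : realType) (d : nat) (Omega : set 'rV[R]_d.+1)
    (f u : 'rV[R]_d.+1 -> R) (C : R)
    (hOmega : bounded_lipschitz_domain Omega)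
    (hf : L2 Omega f)
    (huV : calV Omega u)
    (hu0 : sobolev_H10 Omega u)
    (hu : ae_on Omega (fun x => - weak_laplacian Omega u x = f x))
    (hC0 : 0 < C)
    (hC : (C_P Omega < C%:E)%E) :
  (forall v : 'rV[R]_d.+1 -> R, calV Omega v -> J Omega f C u <= J Omega f C v) /\
  (forall v : 'rV[R]_d.+1 -> R, calV Omega v ->
     (J Omega f C v = J Omega f C u <->
      exists c : R, ae_on Omega (fun x => v x - u x = c))).
Proof.
have [oO nO cO bO _] := hOmega.
split=> [v vV|v vV]; first exact: J_min.
have Lv : L2 Omega v := vV.1.1; have Lu : L2 Omega u := huV.1.1.
have mO := open_measurable_rV oO.
split=> [Jvu|[c vuc]]; last exact: (J_shift oO bO f C Lv Lu vuc).
have Lvu := L2B mO Lv Lu.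
apply: (weak_grad0_constancy oO bO cO nO Lvu) => i phi tphi.
have tdphi := test_L2 oO bO (test_partial i tphi).
have Lphi := test_L2 oO bO tphi.
have vE : ip Omega v (partial i phi) =
    - ip Omega (fun x => weak_grad Omega v x ord0 i) phi.
  by have [_] := weak_gradP vV.1 i; apply.
have uE : ip Omega u (partial i phi) =
    - ip Omega (fun x => weak_grad Omega u x ord0 i) phi.
  by have [_] := weak_gradP huV.1 i; apply.
have gE : ip Omega (fun x => weak_grad Omega v x ord0 i) phi =
    ip Omega (fun x => weak_grad Omega u x ord0 i) phi.
  apply: (eq_ip_ae mO (weak_grad_L2v vV.1 i) (weak_grad_L2v huV.1 i) Lphi).
  exact: (J_eq_grad oO bO hf huV hu0 hu hC0 hC vV Jvu i).
transitivity (ip Omega (fun x => v x - u x) (partial i phi)); first by [].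
by rewrite (ipBl mO Lv Lu tdphi) vE uE gE subrr.
Qed.
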